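(* Let $\lambda\in(-2,2)$. Then the only solution $f\in L_2(\mathbb{R}_+)$ of the integral equation $$2\sqrt{\frac2\pi}\int_0^\infty\left[\cos(xt)+\frac1\pi\sqrt{xt}\,S_{-3/2,-1/2}(xt)\right]f(t)\,dt=\lambda f(x),\quad x>0,$$ is the trivial one $f=0$, and the only solution $f\in L_2(\mathbb{R}_+)$ of the integral equation $$2\sqrt{\frac2\pi}\int_0^\infty\left[\sin(xt)+\frac1\pi\sqrt{xt}\,S_{-1/2,1/2}(xt)\right]f(t)\,dt=\lambda f(x),\quad x>0,$$ is the trivial one $f=0$.
   Context: $\mathbb{R}_+=(0,\infty)$. The integrals are understood in the mean square sense, i.e. as the $L_2(\mathbb{R}_+)$-limit of the integrals over $[1/N,N]$ as $N\to\infty$. Equalities between $L_2$ functions are understood almost everywhere. $S_{\mu,\nu}$ denotes the (second) Lommel function; for the two parameter pairs $(\mu,\nu)$ used here it is the unique solution on $(0,\infty)$ of $z^2w''+zw'+(z^2-\nu^2)w=z^{\mu+1}$ with $w(z)\sim z^{\mu-1}$ as $z\to+\infty$. *)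

(* Defs.v *)
From HB Require Import structures.
From mathcomp Require Import all_boot all_order all_algebra.
From mathcomp Require Import all_classical all_reals all_analysis.
From mathcomp Require Import complex.

Set Implicit Arguments.
Unset Strict Implicit.
Unset Printing Implicit Defensive.

Import Order.TTheory GRing.Theory Num.Theory.
Import numFieldNormedType.Exports.

Local Open Scope complex_scope.
Local Open Scope ring_scope.
Local Open Scope classical_set_scope.

(* Functions on the half-line are represented by functions on the whole of R
   whose values at nonpositive arguments are never used. *)
Definition Rplus (R : realType) : set R := `]0, +oo[%classic.

Definition is_lommelS (R : realType) (mu nu : R) (w : R -> R) : Prop :=
  (forall z : R, 0 < z ->
     [/\ derivable w z 1, derivable w^`() z 1 &
         z ^+ 2 * (w^`(2) z)%classic + z * (w^`() z)%classic + (z ^+ 2 - nu ^+ 2) * w z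
         = z `^ (mu + 1)])
  /\ w z / z `^ (mu - 1) @[z --> +oo] --> (1 : R).

(* "The" solution: when several functions satisfy is_lommelS because they differ
   at nonpositive arguments, one of them is chosen.  The value is meaningful
   only for (mu, nu) such that a solution exists and is unique on (0, +oo). *)
Definition lommelS (R : realType) (mu nu : R) : R -> R :=
  xget (cst 0) [set w : R -> R | is_lommelS mu nu w].

Section L2.
Variable R : realType.
Implicit Types (f g : R -> R[i]) (k : R -> R -> R).

Definition sqr_modulus (z : R[i]) : R := complex.Re z ^+ 2 + complex.Im z ^+ 2.

(* The square of the norm of f in L_2(R_+). *)
Definition sqr_normL2 f : \bar R :=
  (\int[@lebesgue_measure R]_(x in @Rplus R) (sqr_modulus (f x))%:E)%E.

Definition inL2 f : Prop :=
  [/\ measurable_fun (@Rplus R) (fun x => complex.Re (f x)),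
      measurable_fun (@Rplus R) (fun x => complex.Im (f x)) &
      (sqr_normL2 f < +oo)%E].

Definition ae_eq_Rplus f g : Prop :=
  {ae @lebesgue_measure R, forall x, Rplus x -> f x = g x}.

Definition complex_integral (D : set R) f : R[i] :=
  (Rintegral (@lebesgue_measure R) D (fun t => complex.Re (f t)))
  +i* (Rintegral (@lebesgue_measure R) D (fun t => complex.Im (f t))).

Definition truncated_integral k f (N : nat) (x : R) : R[i] :=
  complex_integral `[N%:R^-1, N%:R]%classic (fun t => (k x t)%:C * f t).

(* g(x) = int_0^oo k(x,t) f(t) dt in the mean square sense. *)
Definition is_ms_integral k f g : Prop :=
  inL2 g /\
  sqr_normL2 (fun x => truncated_integral k f N x - g x) @[N --> \oo] --> 0%E.

(* f solves 2 sqrt(2/pi) int_0^oo k(x,t) f(t) dt = lam f(x), x > 0. *)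
Definition solves k (lam : R) f : Prop :=
  exists2 g, is_ms_integral k f g &
    ae_eq_Rplus (fun x => (2 * Num.sqrt (2 / pi))%:C * g x)
                (fun x => lam%:C * f x).

Definition cos_lommel_kernel (x t : R) : R :=
  cos (x * t)
  + pi^-1 * Num.sqrt (x * t) * lommelS (- (3 / 2)) (- (1 / 2)) (x * t).

Definition sin_lommel_kernel (x t : R) : R :=
  sin (x * t)
  + pi^-1 * Num.sqrt (x * t) * lommelS (- (1 / 2)) (1 / 2) (x * t).

End L2.

(* Main.v *)
Require Import Defs.
From mathcomp Require Import all_boot all_order all_algebra.
From mathcomp Require Import all_classical all_reals all_analysis.
From mathcomp Require Import complex ring lra measurable_realfun.

(** Let e be cos (or sin), and let F f(x) = sqrt (2/pi) int_0^oo e(xt) f(t) dt be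
the cosine (or sine) transform, which is unitary on L2(0, oo).  The operator on
the left of each equation is 2 F (1 + C), where C is the Carleman operator
C f(x) = (1/pi) int_0^oo f(t) / (x + t) dt.  Since 1/(s + t) is the integral of
exp(-(s + t) x) over x > 0, one has
    <C f, f> = (1/pi) int_0^oo (int f(t) exp(-x t) dt)^2 dx >= 0,
so |(1 + C) f|^2 >= |f|^2 and the left side has norm at least 2 |f|.  The right
side has norm |lam| |f|, and |lam| < 2 leaves only f = 0.

The factorization comes from the Lommel functions.  When nu^2 = 1/4, the
substitution w(z) = z^(-1/2) y(z) turns the Lommel equation into y'' + y = z^-n
with y ~ z^-n, n = 2 for the cosine kernel and n = 1 for the sine kernel.  A
solution is the Laplace transform of m(u) = u/(1 + u^2), respectively of
m(u) = 1/(1 + u^2) ([cos_profile], [sin_profile]), and it is the only one because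
the difference of two solutions satisfies v'' = -v and tends to 0 at infinity
([harmonic_cvg0_eq0]).  Thus k(x, t) = e(xt) + (1/pi) L(xt) with L the Laplace
transform of m ([cos_lommel_kernelE], [sin_lommel_kernelE]).

The transforms are never composed.  What is proved is their consequence
    (pi/2) int f^2 <= int_0^oo (int k(x, t) f(t) dt)^2 dx
for square integrable f supported in a bounded interval ]a, b[ with a > 0; this
is the predicate [expanding], proved in [kernel_expanding].  Put
u(x) = int f(t) e(xt) dt, y(x) = int f(t) L(xt) dt, and v(x) = int h(t) e(xt) dt
for a bounded continuous function h.  Then for every p > 0
    (u + y/pi)^2 >= exp(-p x) (2 u v - v^2 + (2/pi) u y).
The factor exp(-p x) makes every integral absolutely convergent.  By Fubini, the
integral of exp(-p x) u v involves Poisson kernels of width p and tends to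
(pi/2) int f h as p -> 0 ([cvg_damped_trig_product]), while the integral of
exp(-p x) u y tends to (pi/2) int int f(s) f(t) / (s + t) ds dt >= 0
([cvg_damped_cross_product]).  Choosing h close to f in L2
([continuous_dense_L2]) gives the inequality.  The continuity of h makes
the Poisson integrals converge at every point, by an elementary argument.

To pass to f on the whole half-line, let g be the mean square limit of the
truncated integrals A_N and use
    A_N^2 <= (1 + eta) g^2 + (1 + 1/eta) (A_N - g)^2
before N -> oo.  The equation gives int g^2 = (lam^2/4) (pi/2) int f^2, and eta is
chosen such that (1 + eta) lam^2/4 < 1 ([real_solution_eq0]).  The kernels are
real, so the real and imaginary parts of f are treated separately. *)

Set Implicit Arguments.
Unset Strict Implicit.
Unset Printing Implicit Defensive.

Import Order.TTheory GRing.Theory Num.Theory.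
Import numFieldNormedType.Exports.

Local Open Scope ring_scope.
Local Open Scope classical_set_scope.

(** * Integration of real-valued functions *)

Section integral_tools.
Context d (T : measurableType d) (R : realType) (mu : {measure set T -> \bar R}).
Implicit Types (D : set T) (f g : T -> R).

Lemma integrable_dominated D f g : measurable D -> measurable_fun D f ->
  mu.-integrable D (EFin \o g) -> (forall x, D x -> `|f x| <= g x) ->
  mu.-integrable D (EFin \o f).
Proof.
move=> mD mf ig fg; apply: (le_integrable mD _ _ ig).
- exact/measurable_EFinP.
- by move=> x Dx; rewrite /= lee_fin (le_trans (fg x Dx))// ler_norm.
Qed.

(** The integrable factor comes first: the later kernels are written as
[f t * e (x * t)], with the integrable function on the left of the bounded one. *)
Lemma integrable_mul_bounded D f g (M : R) : measurable D -> measurable_fun D f ->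
  mu.-integrable D (EFin \o g) -> (forall x, D x -> `|f x| <= M) ->
  mu.-integrable D (EFin \o (fun x => g x * f x)).
Proof.
move=> mD mf ig fM.
have mg : measurable_fun D g by case/integrableP : ig => /measurable_EFinP.
apply: (@integrable_dominated _ _ (fun x => M * `|g x|)) => //.
- exact: measurable_funM.
- rewrite (_ : _ \o _ = fun x => (M%:E * (`|(EFin \o g) x|))%E); last first.
    by apply/funext => x /=; rewrite EFinM.
  by apply: integrableZl => //; exact: integrable_abse.
- by move=> x Dx; rewrite normrM mulrC ler_wpM2r// fM.
Qed.

Lemma integrable_EFinD D f g : measurable D -> mu.-integrable D (EFin \o f) ->
  mu.-integrable D (EFin \o g) ->
  mu.-integrable D (EFin \o (fun x => f x + g x)).
Proof.
by move=> mD intf intg; apply: eq_integrable (integrableD mD intf intg).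
Qed.

Lemma integrable_EFinB D f g : measurable D -> mu.-integrable D (EFin \o f) ->
  mu.-integrable D (EFin \o g) ->
  mu.-integrable D (EFin \o (fun x => f x - g x)).
Proof.
by move=> mD intf intg; apply: eq_integrable (integrableB mD intf intg).
Qed.

Lemma integrable_EFinZl D f (r : R) : measurable D ->
  mu.-integrable D (EFin \o f) -> mu.-integrable D (EFin \o (fun x => r * f x)).
Proof.
move=> mD intf; rewrite (_ : _ \o _ = fun x => (r%:E * (EFin \o f) x)%E).
  exact: integrableZl.
by apply/funext => x /=; rewrite EFinM.
Qed.

(** Moves between the real-valued integral, where algebra is possible, and the
extended one, where the monotone and Fubini theorems live. *)
Lemma EFin_Rintegral D f : mu.-integrable D (EFin \o f) -> measurable D ->
  (\int[mu]_(x in D) f x)%:E = (\int[mu]_(x in D) (f x)%:E)%E.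
Proof. by move=> intf mD; rewrite /Rintegral fineK//; exact: integrable_fin_num. Qed.

Lemma Rintegral_dominated_cvg D (f_ : nat -> T -> R) f g : measurable D ->
  (forall n, measurable_fun D (f_ n)) ->
  (forall x, D x -> f_ n x @[n --> \oo] --> f x) ->
  mu.-integrable D (EFin \o g) ->
  (forall n x, D x -> `|f_ n x| <= g x) ->
  mu.-integrable D (EFin \o f) /\
  \int[mu]_(x in D) f_ n x @[n --> \oo] --> \int[mu]_(x in D) f x.
Proof.
move=> mD mf ff ig fg.
have mfE : measurable_fun D f.
  by apply: (measurable_fun_cvg _ ff) => n; exact: mf.
have [||||h1 _ h2] := @dominated_convergence _ _ _ mu _ mD
  (fun n => EFin \o f_ n) (EFin \o f) (EFin \o g) _ _ _ ig _.
- by move=> n; exact/measurable_EFinP.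
- exact/measurable_EFinP.
- by apply: aeW => x Dx; apply: cvg_EFin; [exact: nearW|exact: ff].
- by apply: aeW => x n Dx; rewrite /= lee_fin; exact: fg.
split => //; apply: fine_cvg; rewrite /= fineK//; exact: integrable_fin_num.
Qed.

End integral_tools.

Section fubini_real.
Context d1 d2 (T1 : measurableType d1) (T2 : measurableType d2) (R : realType).
Variables (m1 : {sigma_finite_measure set T1 -> \bar R})
          (m2 : {sigma_finite_measure set T2 -> \bar R}).
Variables (D1 : set T1) (D2 : set T2) (K : T1 -> T2 -> R) (G : T2 -> R).
Hypotheses (mD1 : measurable D1) (mD2 : measurable D2).
Hypothesis mK : measurable_fun (D1 `*` D2) (fun z => K z.1 z.2).
Hypothesis K1 : forall x, D1 x -> m2.-integrable D2 (EFin \o K x).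

Let k := (fun z : T1 * T2 => (K z.1 z.2)%:E) \_ (D1 `*` D2).

Let mk : measurable_fun setT k.
Proof.
apply/(measurable_restrictT _ _).1; first exact: measurableX.
exact/measurable_EFinP.
Qed.

Let kE x y : k (x, y) = ((fun x => ((fun y => (K x y)%:E) \_ D2) y) \_ D1) x.
Proof.
rewrite /k !patchE in_setX/=.
by case: (x \in D1); case: (y \in D2).
Qed.

Let k1 x : (\int[m2]_y k (x, y) = ((fun x => \int[m2]_(y in D2) (K x y)%:E) \_ D1) x)%E.
Proof.
rewrite patchE; case: ifPn => xD1.
  by rewrite [RHS]integral_mkcond; apply: eq_integral => y _; rewrite kE patchE xD1.
by apply: integral0_eq => y _; rewrite kE patchE (negbTE xD1).
Qed.

(** The inner integral of the positive and of the negative part of [K], extended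
by 0 outside [D1 `*` D2], is measurable by the Tonelli theorem. *)
Lemma measurable_Rintegral :
  measurable_fun D1 (fun x => \int[m2]_(y in D2) K x y).
Proof.
have mE : measurable_fun setT (fun x => \int[m2]_y k (x, y))%E.
  apply: (eq_measurable_fun (fun x => (\int[m2]_y k^\+ (x, y) - \int[m2]_y k^\- (x, y))%E)).
    by move=> x _; rewrite [RHS]integralE; congr (_ - _)%E; apply: eq_integral => y _;
      rewrite ?funepos_comp ?funeneg_comp.
  apply: emeasurable_funB; apply: measurable_fun_fubini_tonelli_F => //.
    exact: measurable_funepos.
  exact: measurable_funeneg.
apply: (eq_measurable_fun (fine \o (fun x => \int[m2]_y k (x, y))%E)).
  by move=> x xD1; rewrite /= k1 patchE xD1.
by apply: measurable_funTS; apply: measurableT_comp.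
Qed.

Hypothesis K2 : forall y, D2 y -> m1.-integrable D1 (EFin \o K ^~ y).
Hypothesis intG : m2.-integrable D2 (EFin \o G).
Hypothesis K_G : forall y, D2 y -> \int[m1]_(x in D1) `|K x y| <= G y.

Let k2 y : (\int[m1]_x k (x, y) = ((fun y => \int[m1]_(x in D1) (K x y)%:E) \_ D2) y)%E.
Proof.
rewrite patchE; case: ifPn => yD2.
  rewrite [RHS]integral_mkcond; apply: eq_integral => x _.
  by rewrite kE !patchE yD2.
by apply: integral0_eq => x _; rewrite kE !patchE (negbTE yD2); case: ifP.
Qed.

Let k3 y : (\int[m1]_x `|k (x, y)| = ((fun y => \int[m1]_(x in D1) `|K x y|%:E) \_ D2) y)%E.
Proof.
rewrite patchE; case: ifPn => yD2.
  rewrite [RHS]integral_mkcond; apply: eq_integral => x _.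
  by rewrite kE !patchE yD2; case: ifPn => //; rewrite abse0.
by apply: integral0_eq => x _; rewrite kE !patchE (negbTE yD2); case: ifP; rewrite abse0.
Qed.

Let ik : (m1 \x m2)%E.-integrable setT k.
Proof.
apply/integrable21ltyP => //.
under eq_integral do rewrite k3.
rewrite -integral_mkcond.
have mF : measurable_fun D2 (fun y => \int[m1]_(x in D1) (`|K x y|)%:E)%E.
  apply/(measurable_restrictT _ mD2).2.
  apply: (eq_measurable_fun (fun y => \int[m1]_x (abse \o k) (x, y))%E).
    by move=> y _; rewrite -k3.
  apply: measurable_fun_fubini_tonelli_G => [|z]; last exact: abse_ge0.
  exact: measurableT_comp.
apply: (@le_lt_trans _ _ (\int[m2]_(y in D2) (G y)%:E)%E).
  apply: ge0_le_integral => //.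
  - by move=> y _; apply: integral_ge0.
  - by case/integrableP : intG.
  - move=> y D2y; rewrite -EFin_Rintegral// ?lee_fin ?K_G//.
    exact: (integrable_norm (K2 D2y)).
rewrite -EFin_Rintegral// ltry//.
Qed.

Lemma Rintegral_Fubini_integrable :
  m1.-integrable D1 (EFin \o fun x => \int[m2]_(y in D2) K x y).
Proof.
have := integrable_fubini_F ik; rewrite /fubini_F.
under eq_fun do rewrite k1.
move/(integrable_mkcond _ mD1).2; apply: eq_integrable => // x /set_mem D1x /=.
by rewrite EFin_Rintegral//; exact: K1.
Qed.

Lemma Rintegral_Fubini_integrable2 :
  m2.-integrable D2 (EFin \o fun y => \int[m1]_(x in D1) K x y).
Proof.
have mF : measurable_fun D2 (fun y => \int[m1]_(x in D1) (K x y)%:E)%E.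
  apply/(measurable_restrictT _ mD2).2.
  apply: (eq_measurable_fun (fubini_G m1 k)).
    by move=> y _; rewrite /fubini_G k2.
  exact: (measurable_fubini_G ik).
apply: integrable_dominated intG _ => //.
  apply/measurable_EFinP; apply: eq_measurable_fun mF => y /set_mem D2y /=.
  by rewrite EFin_Rintegral//; exact: K2.
move=> y D2y; apply: le_trans (K_G D2y); apply: le_normr_Rintegral => //.
exact: K2.
Qed.

(** The hypotheses are the ones met in practice: integrability on the product is
deduced, by Tonelli, from an integrable bound [G] of the inner integrals of the
absolute value. *)
Lemma Rintegral_Fubini :
  \int[m1]_(x in D1) (\int[m2]_(y in D2) K x y) =
  \int[m2]_(y in D2) (\int[m1]_(x in D1) K x y).
Proof.
have := Fubini ik.
under eq_integral do rewrite k1.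
under [in RHS]eq_integral do rewrite k2.
rewrite -!integral_mkcond => E; rewrite /Rintegral; congr fine.
transitivity (\int[m1]_(x in D1) \int[m2]_(y in D2) (K x y)%:E)%E.
  apply: eq_integral => x /set_mem D1x.
  by rewrite -[in RHS]EFin_Rintegral//; exact: K1.
rewrite E; apply: eq_integral => y /set_mem D2y.
by rewrite -[in LHS]EFin_Rintegral//; exact: K2.
Qed.

End fubini_real.

(** * Elementary integrals over the half-line *)

Section halfline_integrals.
Variable R : realType.
Notation mu := (@lebesgue_measure R).
Notation D := (@Rplus R).
Implicit Types (f g F G : R -> R) (p s t x : R).

Lemma RplusE x : D x = (0 < x) :> Prop.
Proof. by rewrite /Rplus /= in_itv/= andbT. Qed.

Hint Extern 0 (measurable (@Rplus _)) => solve [exact: measurable_itv] : core.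

Lemma is_derive_continuous f (f' x : R) : is_derive x 1 f f' -> {for x, continuous f}.
Proof.
move=> df; apply: differentiable_continuous; apply/derivable1_diffP.
exact: ex_derive.
Qed.

(** Replaces the raw derivative produced by the differentiation rules by a
simplified expression. *)
Lemma is_derive_congr f g (x a b : R) : is_derive x 1 f a -> f = g -> a = b ->
  is_derive x 1 g b.
Proof. by move=> ? <- <-. Qed.

Lemma ge0_FTC_Rplus f F (l : R) : (forall x, 0 <= x -> 0 <= f x) ->
  continuous f -> (forall x, is_derive x 1 F (f x)) -> F x @[x --> +oo] --> l ->
  mu.-integrable D (EFin \o f) /\ \int[mu]_(x in D) f x = l - F 0.
Proof.
move=> f0 cf dF Fl.
have mf A : measurable A -> measurable_fun A (EFin \o f).
  move=> mA; apply/measurable_EFinP; apply: measurable_funTS.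
  exact: continuous_measurable_fun.
have E : (\int[mu]_(x in D) (f x)%:E = l%:E - (F 0)%:E)%E.
  rewrite /Rplus integral_itv_obnd_cbnd; last exact: mf.
  apply: ge0_continuous_FTC2y => //.
  - exact: continuous_subspaceT.
  - by apply: cvg_at_right_filter; exact: (is_derive_continuous (dF 0)).
  - by move=> x _; rewrite derive1E; have [] := dF x.
split; last by rewrite /Rintegral E.
apply/integrableP; split; first exact: mf.
rewrite (_ : (\int[mu]_(x in D) _)%E = (l - F 0)%:E) ?ltry//.
rewrite EFinB -E; apply: eq_integral => x /set_mem; rewrite RplusE => x0.
by rewrite /= ger0_norm//; exact/f0/ltW.
Qed.

(** A function of varying sign is handled by writing it as (f + g) - g, with both
terms nonnegative when g dominates f. *)
Lemma FTC_Rplus f F (l : R) g G (m : R) :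
  continuous f -> (forall x, is_derive x 1 F (f x)) -> F x @[x --> +oo] --> l ->
  continuous g -> (forall x, is_derive x 1 G (g x)) -> G x @[x --> +oo] --> m ->
  (forall x, 0 <= x -> `|f x| <= g x) ->
  mu.-integrable D (EFin \o f) /\ \int[mu]_(x in D) f x = l - F 0.
Proof.
move=> cf dF Fl cg dG Gm fg.
have g0 x : 0 <= x -> 0 <= g x by move=> x0; rewrite (le_trans _ (fg x x0)).
have [ig Ig] := ge0_FTC_Rplus g0 cg dG Gm.
have fg0 x : 0 <= x -> 0 <= f x + g x.
  by move=> x0; have := fg x x0; rewrite ler_norml => /andP[]; lra.
have cfg : continuous (fun x => f x + g x).
  by move=> x; apply: cvgD; [exact: cf|exact: cg].
have [ifg Ifg] := ge0_FTC_Rplus fg0 cfg (fun x => is_deriveD (dF x) (dG x))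
  (cvgD Fl Gm).
have intf : mu.-integrable D (EFin \o f).
  by apply: eq_integrable (integrable_EFinB _ ifg ig) => // x _ /=; rewrite addrK.
split; first exact: intf.
by move: Ifg; rewrite RintegralD// Ig /= !fctE; lra.
Qed.

Lemma is_derive_expRN p x :
  is_derive x 1 (fun y => expR (- (p * y))) (- p * expR (- (p * x))).
Proof.
have h : is_derive x 1 (fun y => - (p * y)) (- p).
  have := is_deriveN (is_deriveZ p (is_derive_id x 1)).
  by rewrite /GRing.scale /= mulr1.
by have := is_derive1_comp (is_derive_expR _) h; rewrite mulrC.
Qed.

Lemma is_derive_mulr t x : is_derive x 1 (fun y => y * t) t.
Proof.
rewrite (_ : (fun y => y * t) = (fun y => t * y)); last first.
  by apply/funext => y; rewrite mulrC.
by have := is_deriveZ t (is_derive_id x 1); rewrite /GRing.scale /= mulr1.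
Qed.

Lemma is_derive_sinM t x :
  is_derive x 1 (fun y => sin (y * t)) (t * cos (x * t)).
Proof.
by have := is_derive1_comp (is_derive_sin _) (is_derive_mulr t x); rewrite mulrC.
Qed.

Lemma is_derive_cosM t x :
  is_derive x 1 (fun y => cos (y * t)) (- t * sin (x * t)).
Proof.
by have := is_derive1_comp (is_derive_cos _) (is_derive_mulr t x); rewrite mulrC mulrN -mulNr.
Qed.

Lemma cvg_expRN p : 0 < p -> expR (- (p * x)) @[x --> +oo] --> (0 : R).
Proof.
move=> p0; apply: (@cvg_comp _ _ _ (fun x => p * x) (fun y => expR (- y)) _ (pinfty_nbhs R));
  last exact: cvgr_expR.
by apply: gt0_cvgMry => //; exact: cvg_id.
Qed.

Lemma exp_integral p : 0 < p ->
  mu.-integrable D (EFin \o fun x => expR (- (p * x))) /\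
  \int[mu]_(x in D) expR (- (p * x)) = p^-1.
Proof.
move=> p0.
have cE : continuous (fun x => expR (- (p * x))).
  by move=> x; exact: (is_derive_continuous (is_derive_expRN p x)).
have dE x : is_derive x 1 (fun x => - p^-1 * expR (- (p * x))) (expR (- (p * x))).
  have := is_deriveZ (- p^-1) (is_derive_expRN p x).
  by rewrite /GRing.scale /= mulrA mulrNN mulVf ?mul1r// gt_eqF.
have lE : - p^-1 * expR (- (p * x)) @[x --> +oo] --> (0 : R).
  by rewrite -(mulr0 (- p^-1)); apply: cvgMl_tmp; exact: cvg_expRN.
have [h1 h2] := ge0_FTC_Rplus (fun x _ => expR_ge0 _) cE dE lE.
by split => //; rewrite h2 mulr0 oppr0 expR0 mulr1 opprK add0r.
Qed.

Lemma continuous_expRN p : continuous (fun x => expR (- (p * x))).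
Proof. by move=> x; exact: (is_derive_continuous (is_derive_expRN p x)). Qed.

Lemma continuous_cosM t : continuous (fun x => cos (x * t)).
Proof. by move=> x; exact: (is_derive_continuous (is_derive_cosM t x)). Qed.

Lemma continuous_sinM t : continuous (fun x => sin (x * t)).
Proof. by move=> x; exact: (is_derive_continuous (is_derive_sinM t x)). Qed.

Lemma cvg0_dominated f g (C : R) : (forall x, `|f x| <= C * g x) ->
  g x @[x --> +oo] --> (0 : R) -> f x @[x --> +oo] --> (0 : R).
Proof.
move=> fg g0; have Cg : C * g x @[x --> +oo] --> (0 : R).
  by rewrite -(mulr0 C); exact: cvgMl_tmp.
apply: (@squeeze_cvgr _ _ _ _ (fun x => - (C * g x)) (fun x => C * g x)) => //.
  by apply: nearW => x; have := fg x; rewrite ler_norml.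
by rewrite -oppr0; exact: cvgN.
Qed.

(** A primitive of the form exp(-p x) F(x) with F bounded vanishes at infinity; the
dominating function required by the fundamental theorem is exp(-p x) itself. *)
Lemma exp_trig_integral p f F (C : R) : 0 < p -> continuous f ->
  (forall x, `|f x| <= 1) -> (forall x, `|F x| <= C) ->
  (forall x, is_derive x 1 (fun x => expR (- (p * x)) * F x)
                           (expR (- (p * x)) * f x)) ->
  mu.-integrable D (EFin \o fun x => expR (- (p * x)) * f x) /\
  \int[mu]_(x in D) (expR (- (p * x)) * f x) = - F 0.
Proof.
move=> p0 cf f1 FC dF.
have dE x : is_derive x 1 (fun x => - p^-1 * expR (- (p * x))) (expR (- (p * x))).
  have := is_deriveZ (- p^-1) (is_derive_expRN p x).
  by rewrite /GRing.scale /= mulrA mulrNN mulVf ?mul1r// gt_eqF.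
have lE : - p^-1 * expR (- (p * x)) @[x --> +oo] --> (0 : R).
  by rewrite -(mulr0 (- p^-1)); apply: cvgMl_tmp; exact: cvg_expRN.
have cef : continuous (fun x => expR (- (p * x)) * f x).
  by move=> x; apply: cvgM; [exact: continuous_expRN|exact: cf].
have lF : expR (- (p * x)) * F x @[x --> +oo] --> (0 : R).
  apply: (@cvg0_dominated _ (fun x => expR (- (p * x))) C); last exact: cvg_expRN.
  by move=> x; rewrite normrM ger0_norm ?expR_ge0// mulrC ler_wpM2r ?expR_ge0.
have bd x : 0 <= x -> `|expR (- (p * x)) * f x| <= expR (- (p * x)).
  by move=> _; rewrite normrM ger0_norm ?expR_ge0// ler_piMr ?expR_ge0.
have [h1 h2] := FTC_Rplus cef dF lF (@continuous_expRN p) dE lE bd.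
by split => //; rewrite h2 mulr0 oppr0 expR0 mul1r sub0r.
Qed.

Lemma cos_le1 x : `|cos x| <= 1.
Proof. by rewrite ler_norml cos_geN1 cos_le1. Qed.

Lemma sin_le1 x : `|sin x| <= 1.
Proof. by rewrite ler_norml sin_geN1 sin_le1. Qed.

Lemma exp_cos_integral p t : 0 < p ->
  mu.-integrable D (EFin \o fun x => expR (- (p * x)) * cos (x * t)) /\
  \int[mu]_(x in D) (expR (- (p * x)) * cos (x * t)) = p / (p ^+ 2 + t ^+ 2).
Proof.
move=> p0; have q0 : 0 < p ^+ 2 + t ^+ 2 by rewrite ltr_wpDr ?sqr_ge0 ?exprn_gt0.
set q := p ^+ 2 + t ^+ 2 in q0 *.
have [||x|h1 h2] := @exp_trig_integral p (fun x => cos (x * t))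
  (fun x => q^-1 * (t * sin (x * t) - p * cos (x * t))) (q^-1 * (`|t| + `|p|)) p0
  (@continuous_cosM t).
- by move=> x; exact: cos_le1.
- move=> x; rewrite normrM ger0_norm ?invr_ge0 ?(ltW q0)//; apply: ler_wpM2l;
    rewrite ?invr_ge0 ?(ltW q0)//.
  by rewrite (le_trans (ler_normB _ _))// !normrM lerD// ler_piMr ?sin_le1 ?cos_le1.
- have h : is_derive x 1
      (fun x => expR (- (p * x)) * (q^-1 * (t * sin (x * t) - p * cos (x * t))))
      (expR (- (p * x)) * (q^-1 * (t * (t * cos (x * t)) - p * (- t * sin (x * t))))
       + q^-1 * (t * sin (x * t) - p * cos (x * t)) * (- p * expR (- (p * x)))).
    exact: (is_deriveM (is_derive_expRN p x) (is_deriveZ q^-1 (is_deriveB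
      (is_deriveZ t (is_derive_sinM t x)) (is_deriveZ p (is_derive_cosM t x))))).
  by apply: (is_derive_congr h) => //; rewrite /q; field; rewrite gt_eqF.
by split => //; rewrite h2 !mul0r sin0 cos0; field; rewrite gt_eqF.
Qed.

Lemma exp_sin_integral p t : 0 < p ->
  mu.-integrable D (EFin \o fun x => expR (- (p * x)) * sin (x * t)) /\
  \int[mu]_(x in D) (expR (- (p * x)) * sin (x * t)) = t / (p ^+ 2 + t ^+ 2).
Proof.
move=> p0; have q0 : 0 < p ^+ 2 + t ^+ 2 by rewrite ltr_wpDr ?sqr_ge0 ?exprn_gt0.
set q := p ^+ 2 + t ^+ 2 in q0 *.
have [||x|h1 h2] := @exp_trig_integral p (fun x => sin (x * t))
  (fun x => q^-1 * (- p * sin (x * t) - t * cos (x * t))) (q^-1 * (`|p| + `|t|)) p0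
  (@continuous_sinM t).
- by move=> x; exact: sin_le1.
- move=> x; rewrite normrM ger0_norm ?invr_ge0 ?(ltW q0)//; apply: ler_wpM2l;
    rewrite ?invr_ge0 ?(ltW q0)//.
  rewrite (le_trans (ler_normB _ _))// !normrM normrN.
  by rewrite lerD// ler_piMr ?sin_le1 ?cos_le1.
- have h : is_derive x 1
      (fun x => expR (- (p * x)) * (q^-1 * (- p * sin (x * t) - t * cos (x * t))))
      (expR (- (p * x)) * (q^-1 * (- p * (t * cos (x * t)) - t * (- t * sin (x * t))))
       + q^-1 * (- p * sin (x * t) - t * cos (x * t)) * (- p * expR (- (p * x)))).
    exact: (is_deriveM (is_derive_expRN p x) (is_deriveZ q^-1 (is_deriveB
      (is_deriveZ (- p) (is_derive_sinM t x)) (is_deriveZ t (is_derive_cosM t x))))).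
  by apply: (is_derive_congr h) => //; rewrite /q; field; rewrite gt_eqF.
by split => //; rewrite h2 !mul0r sin0 cos0; field; rewrite gt_eqF.
Qed.

(** The primitive is (1/s) atan(s x / t). *)
Lemma lorentz_integral s t : 0 < s -> 0 < t ->
  mu.-integrable D (EFin \o fun x => t / (t ^+ 2 + (s * x) ^+ 2)) /\
  \int[mu]_(x in D) (t / (t ^+ 2 + (s * x) ^+ 2)) = pi / 2 / s.
Proof.
move=> s0 t0.
have q0 x : 0 < t ^+ 2 + (s * x) ^+ 2 by rewrite ltr_wpDr ?sqr_ge0 ?exprn_gt0.
have c0 : continuous (fun x => t / (t ^+ 2 + (s * x) ^+ 2)).
  move=> x; apply: cvgMl_tmp; apply: cvgV; first by rewrite gt_eqF.
  apply: cvgD; first exact: cvg_cst.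
  by apply: (@cvgM _ _ _ _ (fun x => s * x) (fun x => s * x)); apply: cvgMl_tmp; exact: cvg_id.
have d0 x : is_derive x 1 (fun x => s^-1 * atan (x * (s / t)))
    (t / (t ^+ 2 + (s * x) ^+ 2)).
  have h : is_derive x 1 (fun x => s^-1 * atan (x * (s / t)))
      (s^-1 * ((1 + (x * (s / t)) ^+ 2)^-1 * (s / t))).
    exact: (is_deriveZ s^-1
      (is_derive1_comp (is_derive1_atan _) (is_derive_mulr (s / t) x))).
  apply: (is_derive_congr h) => //; field.
  by rewrite !gt_eqF.
have l0 : s^-1 * atan (x * (s / t)) @[x --> +oo] --> s^-1 * (pi / 2).
  apply: cvgMl_tmp.
  apply: (@cvg_comp _ _ _ (fun x => x * (s / t)) atan _ (pinfty_nbhs R)); last exact: cvgy_atan.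
  by apply: gt0_cvgMly; [exact: divr_gt0|exact: cvg_id].
have [h1 h2] := ge0_FTC_Rplus (fun x _ => divr_ge0 (ltW t0) (ltW (q0 x))) c0 d0 l0.
by split => //; rewrite h2 mul0r atan0 mulr0 subr0 mulrC.
Qed.

End halfline_integrals.

(** * The Laplace transform of a bounded function *)

Section laplace.
Variable R : realType.
Notation mu := (@lebesgue_measure R).
Notation D := (@Rplus R).
Implicit Types (m : R -> R) (p z x : R).

Hint Extern 0 (measurable (@Rplus _)) => solve [exact: measurable_itv] : core.

Definition laplace m z := \int[mu]_(x in D) (m x * expR (- (z * x))).

(** Functions on the half-line are total functions known only at positive
arguments, so derivatives are transferred along equality on the half-line. *)
Lemma is_derive_near_pos (f g : R -> R) (z d : R) : 0 < z ->
  (forall x, 0 < x -> f x = g x) -> is_derive z 1 f d -> is_derive z 1 g d.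
Proof.
move=> z0 fg; apply: near_eq_is_derive.
by near=> x; apply: fg; near: x; exact: lt_nbhsr.
Unshelve. all: by end_near. Qed.

(** Half of the exponent absorbs the power, by y^k <= k! exp(y) at y = p x / 2; the
other half keeps the product integrable. *)
Lemma expRN_pow_le k p x : 0 < p -> 0 <= x ->
  x ^+ k * expR (- (p * x)) <= k`!%:R * (2 / p) ^+ k * expR (- (p / 2 * x)).
Proof.
move=> p0 x0; pose y := p / 2 * x.
have y0 : 0 <= y by rewrite mulr_ge0// divr_ge0// ltW.
have yk : y ^+ k <= k`!%:R * expR y.
  case: k => [|k]; first by rewrite expr0 mul1r -expR0 ler_expR.
  rewrite mulrC -ler_pdivrMr ?ltr0n ?fact_gt0//.
  by have := expR_ge1Dxn k y0; lra.
have -> : x = 2 / p * y by rewrite /y; field; rewrite gt_eqF.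
have -> : p * (2 / p * y) = y + y by field; rewrite gt_eqF.
have -> : p / 2 * (2 / p * y) = y by field; rewrite gt_eqF.
have ee : expR y * expR (- y) = 1 by rewrite -expRD subrr expR0.
have -> : (2 / p * y) ^+ k * expR (- (y + y)) =
    (2 / p) ^+ k * (y ^+ k * (expR (- y) * expR (- y))).
  by rewrite exprMn opprD expRD; ring.
have -> : k`!%:R * (2 / p) ^+ k * expR (- y) =
    (2 / p) ^+ k * (k`!%:R * expR y * (expR (- y) * expR (- y))).
  transitivity (k`!%:R * (2 / p) ^+ k * expR (- y) * (expR y * expR (- y))).
    by rewrite ee mulr1.
  by ring.
apply: ler_wpM2l; first by rewrite exprn_ge0// divr_ge0// ltW.
by apply: ler_wpM2r => //; rewrite mulr_ge0 ?expR_ge0.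
Qed.

(** The bound is of order p^-(k+1), the exact order of the Laplace transform of
x^k; it drives the asymptotics of the solutions of the Lommel equation. *)
Lemma pow_expRN_integrable m k p : measurable_fun D m ->
  (forall x, 0 < x -> `|m x| <= 1) -> 0 < p ->
  mu.-integrable D (EFin \o fun x => x ^+ k * m x * expR (- (p * x))) /\
  `|laplace (fun x => x ^+ k * m x) p| <= k`!%:R * (2 / p) ^+ k.+1.
Proof.
move=> mm m1 p0; have p20 : 0 < p / 2 by rewrite divr_gt0.
have [ie Ie] := exp_integral p20.
have iC : mu.-integrable D
    (EFin \o fun x => k`!%:R * (2 / p) ^+ k * expR (- (p / 2 * x))).
  exact: integrable_EFinZl.
have bd x : D x -> `|x ^+ k * m x * expR (- (p * x))| <=
    k`!%:R * (2 / p) ^+ k * expR (- (p / 2 * x)).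
  rewrite RplusE => x0; apply: le_trans (expRN_pow_le k p0 (ltW x0)).
  rewrite !normrM (ger0_norm (expR_ge0 _)); apply: ler_wpM2r; first exact: expR_ge0.
  have xk : 0 <= x ^+ k by rewrite exprn_ge0// ltW.
  by rewrite (ger0_norm xk) ler_piMr// m1.
have me : measurable_fun D (fun x => x ^+ k * m x * expR (- (p * x))).
  apply: measurable_funM.
    by apply: measurable_funM => //; exact: measurable_funX.
  by apply: measurable_funTS; apply: continuous_measurable_fun; exact: continuous_expRN.
have it : mu.-integrable D (EFin \o fun x => x ^+ k * m x * expR (- (p * x))).
  exact: integrable_dominated iC bd.
split => //; rewrite /laplace.
apply: le_trans (le_normr_Rintegral _ it) _ => //.
apply: le_trans (le_Rintegral _ _ iC bd) _ => //.
  exact: (integrable_norm it).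
rewrite RintegralZl// Ie exprSr mulrA (_ : (p / 2)^-1 = 2 / p)//.
by field; rewrite gt_eqF.
Qed.

(** Differentiation under the integral sign.  Near z the parameter stays above z/2,
so the derivative of the integrand is dominated by its value at z/2. *)
Lemma is_derive_laplace m k z : measurable_fun D m ->
  (forall x, 0 < x -> `|m x| <= 1) -> 0 < z ->
  is_derive z 1 (laplace (fun x => x ^+ k * m x))
                (- laplace (fun x => x ^+ k.+1 * m x) z).
Proof.
move=> mm m1 z0.
pose f := fun z x => x ^+ k * m x * expR (- (z * x)).
have z20 : 0 < z / 2 by rewrite divr_gt0.
have Iz : `](z / 2), (z + 1)[%classic z by rewrite /= in_itv/=; apply/andP; split; lra.
have I0 x : `](z / 2), (z + 1)[%classic x -> 0 < x.
  by rewrite /= in_itv/= => /andP[+ _]; exact: lt_trans.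
have intf x : `](z / 2), (z + 1)[%classic x -> mu.-integrable D (EFin \o f x).
  by move=> /I0 x0; have [] := pow_expRN_integrable k mm m1 x0.
have df x y : is_derive x 1 (f ^~ y) (- (y ^+ k.+1 * m y * expR (- (x * y)))).
  have h : is_derive x 1 (fun x => y ^+ k * m y * expR (- (y * x)))
      (y ^+ k * m y * (- y * expR (- (y * x)))).
    exact: (is_deriveZ _ (is_derive_expRN y x)).
  apply: (is_derive_congr h); first by apply/funext => u; rewrite /f [y * u]mulrC.
  by rewrite exprS [y * x]mulrC; ring.
have d1 x y : partial1of2 f x y = - (y ^+ k.+1 * m y * expR (- (x * y))).
  by rewrite partial1of2E; have [_ ->] := df x y.
pose G y := `|y ^+ k.+1 * m y * expR (- (z / 2 * y))|.
have G0 y : 0 <= G y by exact: normr_ge0.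
have intG : mu.-integrable D (EFin \o G).
  by have [/integrable_norm ? _] := pow_expRN_integrable k.+1 mm m1 z20.
have fG x y : `](z / 2), (z + 1)[%classic x -> D y -> `|partial1of2 f x y| <= G y.
  move=> Ix; rewrite RplusE => y0; rewrite d1 /G normrN normrM [leRHS]normrM.
  apply: ler_wpM2l => //; rewrite !ger0_norm ?expR_ge0// ler_expR lerN2.
  apply: ler_wpM2r; first exact: ltW.
  by move: Ix; rewrite /= in_itv/= => /andP[/ltW].
have drv x y : `](z / 2), (z + 1)[%classic x -> D y -> derivable (f ^~ y) x 1.
  by move=> _ _; have [] := df x y.
apply: DeriveDef.
  by apply: (derivable_under_integral _ Iz intf drv G0 intG fG).
rewrite -derive1E (differentiation_under_integral _ Iz intf drv G0 intG fG)//.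
rewrite -mulN1r /laplace -RintegralZl//; last first.
  by have [] := pow_expRN_integrable k.+1 mm m1 z0.
by apply: eq_Rintegral => y _; rewrite d1 mulN1r.
Qed.

End laplace.

(** * The Lommel equation with nu^2 = 1/4 *)

Section lommel.
Variable R : realType.
Notation mu := (@lebesgue_measure R).
Notation D := (@Rplus R).
Implicit Types (m : R -> R) (p z x : R).

Hint Extern 0 (measurable (@Rplus _)) => solve [exact: measurable_itv] : core.

Definition twice_derivative (w w1 w2 : R -> R) := forall z : R, 0 < z ->
  is_derive z 1 w (w1 z) /\ is_derive z 1 w1 (w2 z).

Lemma derive1_pos (f g : R -> R) : (forall z : R, 0 < z -> is_derive z 1 f (g z)) ->
  forall z, 0 < z -> f^`() z = g z.
Proof. by move=> fg z z0; rewrite derive1E; have [_ ->] := fg z z0. Qed.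

(** Explicit derivatives are easier to combine than iterated derivatives of a
function that is arbitrary at nonpositive arguments. *)
Lemma is_lommelSP (mu' nu : R) (w : R -> R) : is_lommelS mu' nu w <->
  (exists w1 w2, twice_derivative w w1 w2 /\ forall z, 0 < z ->
     z ^+ 2 * w2 z + z * w1 z + (z ^+ 2 - nu ^+ 2) * w z = z `^ (mu' + 1)) /\
  w z / z `^ (mu' - 1) @[z --> +oo] --> (1 : R).
Proof.
split=> -[h l]; split => //.
  exists w^`(), (w^`(2))%classic; split.
    move=> z z0; have [d1 d2 _] := h z z0; split.
      exact: DeriveDef d1 (esym (derive1E _ _)).
    exact: DeriveDef d2 (esym (derive1E _ _)).
  by move=> z z0; have [_ _] := h z z0.
move=> z z0; have [w1 [w2 [d e]]] := h.
have dw : forall x, 0 < x -> w^`() x = w1 x.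
  by apply: derive1_pos => x x0; case: (d x x0).
have dw1 : is_derive z 1 w^`() (w2 z).
  by apply: (is_derive_near_pos z0 _ (d z z0).2) => x x0; rewrite dw.
split; first by have [[]] := d z z0.
  by case: dw1.
rewrite -(e z z0) dw//; congr (_ * _ + _ + _).
by rewrite [LHS](derive1E w^`() z); case: dw1.
Qed.

Lemma zero_derive_pos (f : R -> R) : (forall z : R, 0 < z -> is_derive z 1 f 0) ->
  forall x y, 0 < x -> 0 < y -> f x = f y.
Proof.
move=> df x y; wlog xy : x y / x <= y.
  by move=> h x0 y0; have [/h->|/ltW/h->] := leP x y.
move=> x0 y0.
have dz z : z \in `]x, y[%R -> is_derive z 1 f (cst 0 z).
  by rewrite in_itv/= => /andP[xz _]; apply: df; exact: lt_trans xz.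
have cf : {within `[x, y], continuous f}.
  apply: derivable_within_continuous => z /itvP zxy.
  by have [] := df z (lt_le_trans x0 _); rewrite ?zxy.
have [c _] := MVT_segment xy dz cf.
by rewrite mul0r => /eqP; rewrite subr_eq0 => /eqP.
Qed.

(** The functions v cos - v' sin and v sin + v' cos are constant, and v is a
combination of them.  At the points 2 pi n, respectively pi/2 + 2 pi n, they equal
v, which tends to 0 along these points, so both constants are 0. *)
Lemma harmonic_cvg0_eq0 (v v1 : R -> R) : twice_derivative v v1 (fun z => - v z) ->
  v z @[z --> +oo] --> (0 : R) -> forall z, 0 < z -> v z = 0.
Proof.
move=> dv v0.
pose c1 z := v z * cos z - v1 z * sin z.
pose c2 z := v z * sin z + v1 z * cos z.
have dc1 z : 0 < z -> is_derive z 1 c1 0.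
  move=> z0; have [h1 h2] := dv z z0.
  have h : is_derive z 1 c1 (v z * (- sin z) + cos z * v1 z
      - (v1 z * cos z + sin z * (- v z))).
    exact: (is_deriveB (is_deriveM h1 (is_derive_cos z)) (is_deriveM h2 (is_derive_sin z))).
  by apply: (is_derive_congr h) => //; ring.
have dc2 z : 0 < z -> is_derive z 1 c2 0.
  move=> z0; have [h1 h2] := dv z z0.
  have h : is_derive z 1 c2 (v z * cos z + sin z * v1 z
      + (v1 z * - sin z + cos z * (- v z))).
    exact: (is_deriveD (is_deriveM h1 (is_derive_sin z)) (is_deriveM h2 (is_derive_cos z))).
  by apply: (is_derive_congr h) => //; ring.
pose a n : R := pi *+ 2 *+ n.+1.
have a0 n : 0 < a n by rewrite /a pmulrn_lgt0// pmulrn_lgt0// pi_gt0.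
have pi0 := pi_gt0 R.
have a_pinfty (b : R) : b + a n @[n --> \oo] --> +oo.
  apply/cvgryPge => M; have := nbhs_infty_ger (M - b); apply: filterS => n Mn.
  rewrite -lerBlDl (le_trans Mn)// /a -[pi *+ 2 *+ _]mulr_natr -[leLHS]mul1r.
  apply: ler_pM; rewrite ?ler0n ?ler_nat//.
  by have := pi_ge2 R; rewrite mulr2n; lra.
have va b : v (b + a n) @[n --> \oo] --> (0 : R).
  by apply: (cvg_comp _ _ (a_pinfty b) v0).
have ca b n : cos (b + a n) = cos b by exact: (periodicn (@cosD2pi R)).
have sa b n : sin (b + a n) = sin b by exact: (periodicn (@sinD2pi R)).
have c1E z : 0 < z -> c1 z = 0.
  move=> z0; have := va 0.
  rewrite (_ : (fun n => v (0 + a n)) = cst (c1 z)).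
    by move=> h; exact: (cvg_unique _ (@cvg_cst _ _ _ _ _) h).
  apply/funext => n /=; rewrite (zero_derive_pos dc1 z0 (a0 n)) /c1.
  by have := ca 0 n; have := sa 0 n; rewrite !add0r cos0 sin0 => -> ->;
    rewrite mulr1 mulr0 subr0.
have c2E z : 0 < z -> c2 z = 0.
  move=> z0; have := va (pi / 2).
  rewrite (_ : (fun n => v (pi / 2 + a n)) = cst (c2 z)).
    by move=> h; exact: (cvg_unique _ (@cvg_cst _ _ _ _ _) h).
  apply/funext => n /=; have an0 : 0 < pi / 2 + a n by rewrite addr_gt0 ?divr_gt0.
  rewrite (zero_derive_pos dc2 z0 an0) /c2.
  by rewrite ca sa cos_pihalf sin_pihalf mulr1 mulr0 addr0.
move=> z z0; have := cos2Dsin2 z; have := c1E z z0; have := c2E z z0.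
rewrite /c1 /c2 => e2 e1 cs.
rewrite -[LHS]mulr1 -cs.
transitivity (cos z * (v z * cos z - v1 z * sin z)
  + sin z * (v z * sin z + v1 z * cos z)); first by ring.
by rewrite e1 e2 !mulr0 addr0.
Qed.

(** The decaying solution of y'' + y = z^-n.  It is the function y such that
z^(-1/2) y(z) is the Lommel function with mu = 1/2 - n and nu^2 = 1/4. *)
Definition lommel_profile (n : nat) (y : R -> R) := exists y1 y2,
  [/\ twice_derivative y y1 y2,
      forall z, 0 < z -> y2 z + y z = z ^- n &
      z ^+ n * y z @[z --> +oo] --> (1 : R)].

Lemma is_derive_inv (z : R) : z != 0 -> is_derive z 1 (fun x : R => x^-1) (- z ^- 2).
Proof.
move=> zn0; have dz := @derivable_id R R^o z 1.
apply: DeriveDef; first exact: (@derivableV _ _ id).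
by rewrite (@deriveV _ _ id)// derive_id /GRing.scale /= mulr1.
Qed.

Lemma is_derive_powR_div (a z : R) : 0 < z ->
  is_derive z 1 (fun x => x `^ a) (a * z `^ a / z).
Proof.
move=> z0; apply: (is_derive_congr (is_derive1_powR a z0)) => //.
by rewrite powRB ?(gt_eqF z0) ?implybT// powRr1 ?(ltW z0)// mulrA.
Qed.

(** The normalization w(z) ~ z^(mu - 1) with mu = 1/2 - n reads y(z) ~ z^-n. *)
Lemma cvg_div_powR (w y : R -> R) (n : nat) :
  (forall z, 0 < z -> w z = z `^ (- (1 / 2)) * y z) ->
  forall l : R, w z / z `^ (1 / 2 - n%:R - 1) @[z --> +oo] --> l <->
  z ^+ n * y z @[z --> +oo] --> l.
Proof.
move=> wy l.
have E : \forall z \near +oo, w z / z `^ (1 / 2 - n%:R - 1) = z ^+ n * y z.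
  near=> z; have z0 : 0 < z by near: z; exact: nbhs_pinfty_gt.
  rewrite wy// -powRN mulrAC -powRD ?(gt_eqF z0) ?implybT//.
  rewrite (_ : _ + _ = n%:R); last by lra.
  by rewrite powR_mulrn// ltW.
split=> h; apply: cvg_trans h; apply: near_eq_cvg; first exact: filterS E.
by apply: filterS E.
Unshelve. all: by end_near. Qed.

(** For w = z^(-1/2) y the first-order terms cancel, and z^2 w'' + z w' + (z^2 - nu^2) w
becomes z^(3/2) (y'' + (1 + (1/4 - nu^2) / z^2) y). *)
Lemma lommel_of_profile n y (nu : R) : nu ^+ 2 = 1 / 4 -> lommel_profile n y ->
  is_lommelS (1 / 2 - n%:R) nu (fun z => z `^ (- (1 / 2)) * y z).
Proof.
move=> nu2 [y1 [y2 [dy ey ly]]]; apply/is_lommelSP; split; last first.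
  by apply/(@cvg_div_powR _ y n).
pose r z : R := z `^ (- (1 / 2)).
have dr z : 0 < z -> is_derive z 1 r (- (1 / 2) * r z / z) by exact: is_derive_powR_div.
(* The first two derivatives of z^(-1/2) y(z), by the product rule. *)
exists (fun z => r z * y1 z + y z * (- (1 / 2) * r z / z)).
exists (fun z => r z * (y2 z - y1 z / z + 3 / 4 * y z / z ^+ 2)); split.
  move=> z z0; have [d1 d2] := dy z z0; split; first exact: (is_deriveM (dr z z0) d1).
  have dV := is_derive_inv (lt0r_neq0 z0).
  have h : is_derive z 1 (fun z => r z * y1 z + y z * (- (1 / 2) * r z / z))
      (r z * y2 z + y1 z * (- (1 / 2) * r z / z) +
      (y z * ((- (1 / 2) * r z) * (- z ^- 2) + z^-1 * (- (1 / 2) * (- (1 / 2) * r z / z)))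
       + (- (1 / 2) * r z / z) * y1 z)).
    exact: (is_deriveD (is_deriveM (dr z z0) d2) (is_deriveM d1
      (is_deriveM (is_deriveZ (- (1 / 2)) (dr z z0)) dV))).
  by apply: (is_derive_congr h) => //; field; rewrite gt_eqF.
move=> z z0; rewrite nu2 -/(r z).
have -> : z `^ (1 / 2 - n%:R + 1) = r z * z ^+ 2 * z ^- n.
  rewrite /r -powR_mulrn ?(ltW z0)// -powR_mulrn ?(ltW z0)// -powRN.
  by rewrite -!powRD ?(gt_eqF z0) ?implybT//; congr (_ `^ _); lra.
by rewrite -ey//; field; rewrite gt_eqF.
Qed.

End lommel.

(** * The Lommel functions as Laplace transforms *)

Section lommel_laplace.
Variable R : realType.
Notation mu := (@lebesgue_measure R).
Notation D := (@Rplus R).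
Implicit Types (m : R -> R) (p z x : R).

Hint Extern 0 (measurable (@Rplus _)) => solve [exact: measurable_itv] : core.

(** The Laplace transforms of these two functions are the classical auxiliary
functions of the sine and cosine integrals. *)
Definition sin_density x : R := (1 + x ^+ 2)^-1.
Definition cos_density x : R := x * (1 + x ^+ 2)^-1.

Lemma oneDsq_gt0 x : 0 < 1 + x ^+ 2.
Proof. by rewrite ltr_pwDl// sqr_ge0. Qed.

Lemma continuous_sin_density : continuous sin_density.
Proof. exact: continuous_oneDsqrV. Qed.

Lemma continuous_cos_density : continuous cos_density.
Proof. by move=> x; apply: cvgM; [exact: cvg_id|exact: continuous_sin_density]. Qed.

Lemma sin_density_le1 x : `|sin_density x| <= 1.
Proof.
rewrite /sin_density ger0_norm ?invr_ge0 ?(ltW (oneDsq_gt0 _))// invf_le1 ?oneDsq_gt0//.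
by rewrite lerDl sqr_ge0.
Qed.

Lemma cos_density_le1 x : `|cos_density x| <= 1.
Proof.
rewrite /cos_density normrM (@ger0_norm _ (_^-1)) ?invr_ge0 ?(ltW (oneDsq_gt0 _))//.
rewrite ler_pdivrMr ?oneDsq_gt0// mul1r ler_norml.
by have := sqr_ge0 (x - 1); have := sqr_ge0 (x + 1); nra.
Qed.

Lemma measurable_continuous_Rplus m : continuous m -> measurable_fun D m.
Proof. by move=> cm; apply: measurable_funTS; exact: continuous_measurable_fun. Qed.

Lemma laplace1 z : 0 < z -> laplace (fun x => x ^+ 0 * (cst 1 x : R)) z = z^-1.
Proof.
move=> z0; have [_ <-] := exp_integral z0.
by apply: eq_Rintegral => x _; rewrite expr0 !mul1r.
Qed.

(** Minus the derivative of the Laplace transform 1/z of the constant 1. *)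
Lemma laplaceX z : 0 < z -> laplace (fun x => x ^+ 1 * (cst 1 x : R)) z = z ^- 2.
Proof.
move=> z0; have m1 (x : R) : 0 < x -> `|cst 1 x : R| <= 1 by rewrite normr1.
have h1 := @is_derive_laplace R (cst 1) 0 z (measurable_cst _) m1 z0.
have h2 := is_derive_near_pos z0 (@laplace1) h1.
have [_ e1] := h2; have [_ e2] := is_derive_inv (lt0r_neq0 z0).
by apply: oppr_inj; rewrite -e1 -e2.
Qed.

Lemma cvg_inv : (z : R)^-1 @[z --> +oo] --> (0 : R).
Proof.
apply/(@gtr0_cvgV0 R R (pinfty_nbhs R) _ id); last exact: cvg_id.
exact: nbhs_pinfty_gt.
Qed.

Lemma cvg_invXn n : (z : R) ^- n.+1 @[z --> +oo] --> (0 : R).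
Proof.
elim: n => [|n ih]; first exact: cvg_inv.
under eq_fun do rewrite exprS invfM.
by rewrite -(mulr0 0); apply: cvgM => //; exact: cvg_inv.
Qed.

(** Differentiating the Laplace transform L of m twice multiplies m by x^2, so
y'' + y = z^-n says that x^2 m + m has Laplace transform z^-n.  The bound says
that L'' is of lower order than z^-n, whence L = z^-n - L'' ~ z^-n. *)
Lemma laplace_profile n m (C : R) : measurable_fun D m ->
  (forall x, 0 < x -> `|m x| <= 1) ->
  (forall z, 0 < z -> laplace (fun x => x ^+ 2 * m x) z + laplace m z = z ^- n) ->
  (forall z, 0 < z -> `|laplace (fun x => x ^+ 2 * m x) z| <= C / z ^+ n.+1) ->
  lommel_profile n (laplace m).
Proof.
move=> mm m1 e b.
exists (fun z => - laplace (fun x => x ^+ 1 * m x) z), (laplace (fun x => x ^+ 2 * m x)).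
split => //.
  move=> z z0; split.
    have := is_derive_laplace 0 mm m1 z0.
    by under [X in laplace X]eq_fun do rewrite expr0 mul1r.
  have h := is_deriveN (is_derive_laplace 1 mm m1 z0).
  by apply: (is_derive_congr h) => //; rewrite opprK.
have zn0 : z ^+ n * laplace (fun x => x ^+ 2 * m x) z @[z --> +oo] --> (0 : R).
  have CV : C * z^-1 @[z --> +oo] --> (0 : R).
    rewrite -(mulr0 C); by apply: cvgMl_tmp; exact: cvg_inv.
  apply: (@squeeze_cvgr _ _ _ _ (fun z => - (C * z^-1)) (fun z => C * z^-1)) => //.
    near=> z; have z0 : 0 < z by near: z; exact: nbhs_pinfty_gt.
    have zn : 0 < z ^+ n by rewrite exprn_gt0.
    rewrite -ler_norml normrM (gtr0_norm zn) mulrC -ler_pdivlMr//.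
    by rewrite (le_trans (b z z0))// exprS invfM mulrA.
  by rewrite -oppr0; exact: cvgN.
(* The differential equation multiplied by z^n. *)
have E : \forall z \near +oo, 1 - z ^+ n * laplace (fun x => x ^+ 2 * m x) z = z ^+ n * laplace m z.
  near=> z; have z0 : 0 < z by near: z; exact: nbhs_pinfty_gt.
  have <- : z ^+ n * z ^- n = 1 by rewrite divff// expf_neq0// gt_eqF.
  by rewrite -(e z z0); ring.
have l1 : 1 - z ^+ n * laplace (fun x => x ^+ 2 * m x) z @[z --> +oo] --> (1 : R).
  by rewrite -[X in _ --> X]subr0; apply: cvgB => //; exact: cvg_cst.
apply: cvg_trans l1; apply: near_eq_cvg; exact: filterS E.
Unshelve. all: by end_near. Qed.

(** Here (1 + x^2) m(x) = 1, whose Laplace transform is 1/z, and x^2 m(x) = x c(x)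
with c = [cos_density] bounded by 1, so that L'' is of order z^-2. *)
Lemma sin_profile : lommel_profile 1 (laplace sin_density).
Proof.
have ms := measurable_continuous_Rplus continuous_sin_density.
have s1 x : 0 < x -> `|sin_density x| <= 1 by move=> _; exact: sin_density_le1.
have mc := measurable_continuous_Rplus continuous_cos_density.
have c1 x : 0 < x -> `|cos_density x| <= 1 by move=> _; exact: cos_density_le1.
apply: (@laplace_profile _ _ 4) => // z z0.
  rewrite expr1 -laplace1//; have [i2 _] := pow_expRN_integrable 2 ms s1 z0.
  have [i0 _] := pow_expRN_integrable 0 ms s1 z0.
  have E : laplace sin_density z = laplace (fun x => x ^+ 0 * sin_density x) z.
    by apply: eq_Rintegral => x _; rewrite expr0 mul1r.
  rewrite E /laplace -RintegralD//; apply: eq_Rintegral => x _.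
  rewrite -mulrDl /sin_density /=; congr (_ * _); field.
  by rewrite gt_eqF// oneDsq_gt0.
have [_] := pow_expRN_integrable 1 mc c1 z0.
rewrite (_ : laplace (fun x => _ * sin_density x) z = laplace (fun x => x ^+ 1 * cos_density x) z).
  by move/le_trans; apply; rewrite factS fact0 mul1r expr_div_n -natrX.
by apply: eq_Rintegral => x _; rewrite /sin_density /cos_density; ring.
Qed.

(** Here (1 + x^2) m(x) = x, whose Laplace transform is z^-2, and |m| <= 1 makes L''
of order z^-3. *)
Lemma cos_profile : lommel_profile 2 (laplace cos_density).
Proof.
have mc := measurable_continuous_Rplus continuous_cos_density.
have c1 x : 0 < x -> `|cos_density x| <= 1 by move=> _; exact: cos_density_le1.
apply: (@laplace_profile _ _ 16) => // z z0; last first.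
  have [_] := pow_expRN_integrable 2 mc c1 z0.
  by move/le_trans; apply; rewrite expr_div_n -natrX mulrA -natrM.
rewrite -laplaceX//; have [i2 _] := pow_expRN_integrable 2 mc c1 z0.
have [i0 _] := pow_expRN_integrable 0 mc c1 z0.
have E : laplace cos_density z = laplace (fun x => x ^+ 0 * cos_density x) z.
  by apply: eq_Rintegral => x _; rewrite expr0 mul1r.
rewrite E /laplace -RintegralD//; apply: eq_Rintegral => x _.
rewrite -mulrDl /cos_density /=; congr (_ * _); field.
by rewrite gt_eqF// oneDsq_gt0.
Qed.

(** With d = w - w' and s = z^(1/2), the function v = s d satisfies v'' = -v, because
nu^2 = 1/4.  Moreover v tends to 0: it is z^-n times a difference of two functions
that tend to 1, and n > 0. *)
Lemma lommel_unique n (nu : R) w w' : nu ^+ 2 = 1 / 4 ->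
  is_lommelS (1 / 2 - n.+1%:R) nu w -> is_lommelS (1 / 2 - n.+1%:R) nu w' ->
  forall z, 0 < z -> w z = w' z.
Proof.
move=> nu2 /is_lommelSP[[w1 [w2 [dw ew]]] lw] /is_lommelSP[[w1' [w2' [dw' ew']]] lw'].
pose d z := w z - w' z; pose d1 z := w1 z - w1' z; pose d2 z := w2 z - w2' z.
have dd z : 0 < z -> is_derive z 1 d (d1 z) /\ is_derive z 1 d1 (d2 z).
  move=> z0; have [h1 h2] := dw z z0; have [h1' h2'] := dw' z z0.
  by split; exact: is_deriveB.
have ed z : 0 < z -> d2 z = - (d1 z / z) - (1 - (4 * z ^+ 2)^-1) * d z.
  move=> z0; have := ew z z0; rewrite -(ew' z z0) nu2 => h.
  have zn0 : z != 0 by rewrite gt_eqF.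
  apply: (mulfI (expf_neq0 2 zn0)).
  have -> : z ^+ 2 * (- (d1 z / z) - (1 - (4 * z ^+ 2)^-1) * d z) =
     - z * d1 z - (z ^+ 2 - 1 / 4) * d z by field.
  by rewrite /d2 /d1 /d; lra.
pose s z : R := z `^ (1 / 2).
have ds z : 0 < z -> is_derive z 1 s (1 / 2 * s z / z) by exact: is_derive_powR_div.
pose v z := s z * d z.
have dv : twice_derivative v (fun z => s z * d1 z + d z * (1 / 2 * s z / z)) (fun z => - v z).
  move=> z z0; have [h1 h2] := dd z z0; have zn0 : z != 0 by rewrite gt_eqF.
  split; first exact: (is_deriveM (ds z z0) h1).
  have h : is_derive z 1 (fun z => s z * d1 z + d z * (1 / 2 * s z / z))
    (s z * d2 z + d1 z * (1 / 2 * s z / z) +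
     (d z * ((1 / 2 * s z) * (- z ^- 2) + z^-1 * (1 / 2 * (1 / 2 * s z / z)))
      + (1 / 2 * s z / z) * d1 z)).
    exact: (is_deriveD (is_deriveM (ds z z0) h2) (is_deriveM h1
      (is_deriveM (is_deriveZ (1 / 2) (ds z z0)) (is_derive_inv zn0)))).
  by apply: (is_derive_congr h) => //; rewrite (ed z z0) /v; field.
have lv : v z @[z --> +oo] --> (0 : R).
  have l0 : (w z / z `^ (1 / 2 - n.+1%:R - 1) - w' z / z `^ (1 / 2 - n.+1%:R - 1)) * z ^- n.+1
      @[z --> +oo] --> (0 : R).
    rewrite -[X in _ --> X](mul0r 0) -{1}(subrr 1); apply: cvgM; first exact: cvgB.
    exact: cvg_invXn.
  apply: cvg_trans l0; apply: near_eq_cvg; near=> z.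
  have z0 : 0 < z by near: z; exact: nbhs_pinfty_gt.
  rewrite -mulrBl -mulrA mulrC /v; congr (_ * _).
  rewrite -powRN -powR_invn ?(ltW z0)// -powRD ?(gt_eqF z0) ?implybT//.
  by rewrite /s; congr (_ `^ _); lra.
move=> z z0; have := harmonic_cvg0_eq0 dv lv z0.
move/eqP; rewrite mulf_eq0 gt_eqF ?powR_gt0//= subr_eq0 => /eqP; exact.
Unshelve. all: by end_near. Qed.

(** [lommelS] chooses one of the solutions, which exist by [lommel_of_profile] and
agree at positive arguments by [lommel_unique]. *)
Lemma lommelS_profile n (nu : R) y : nu ^+ 2 = 1 / 4 -> lommel_profile n.+1 y ->
  forall z, 0 < z -> Num.sqrt z * lommelS (1 / 2 - n.+1%:R) nu z = y z.
Proof.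
move=> nu2 py z z0; have hw := lommel_of_profile nu2 py.
have hS : is_lommelS (1 / 2 - n.+1%:R) nu (lommelS (1 / 2 - n.+1%:R) nu).
  by apply: (@xgetPex _ _ [set w | is_lommelS (1 / 2 - n.+1%:R) nu w]); eexists; exact: hw.
rewrite (lommel_unique nu2 hS hw z0) -powR12_sqrt ?(ltW z0)// mulrA.
rewrite -powRD ?(gt_eqF z0) ?implybT// (_ : _ + _ = 0) ?powRr0 ?mul1r//; lra.
Qed.

Lemma cos_lommel_kernelE (x t : R) : 0 < x -> 0 < t ->
  cos_lommel_kernel x t = cos (x * t) + pi^-1 * laplace cos_density (x * t).
Proof.
move=> x0 t0; rewrite /cos_lommel_kernel -mulrA (_ : - (3 / 2) = 1 / 2 - 2%:R); last lra.
rewrite (lommelS_profile _ cos_profile) ?mulr_gt0//; lra.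
Qed.

Lemma sin_lommel_kernelE (x t : R) : 0 < x -> 0 < t ->
  sin_lommel_kernel x t = sin (x * t) + pi^-1 * laplace sin_density (x * t).
Proof.
move=> x0 t0; rewrite /sin_lommel_kernel -mulrA (_ : - (1 / 2) = 1 / 2 - 1%:R); last lra.
rewrite (lommelS_profile _ sin_profile) ?mulr_gt0//; lra.
Qed.

End lommel_laplace.

(** * Bounded kernels between integrable functions *)

Section fubini_bounded.
Context d1 d2 (T1 : measurableType d1) (T2 : measurableType d2) (R : realType).

Lemma measurable_section (D1 : set T1) (D2 : set T2) (K : T1 -> T2 -> R) x :
  measurable D1 -> measurable D2 ->
  measurable_fun (D1 `*` D2) (fun z => K z.1 z.2) -> D1 x -> measurable_fun D2 (K x).
Proof.
move=> mD1 mD2 mK D1x.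
apply: (@measurable_comp _ _ _ _ _ _ (D1 `*` D2) (fun z => K z.1 z.2) D2 (fun y => (x, y))) => //.
  exact: measurableX.
by move=> _ [y D2y <-].
exact: measurable_funTS (measurable_pair1 x).
Qed.

Lemma measurable_section2 (D1 : set T1) (D2 : set T2) (K : T1 -> T2 -> R) y :
  measurable D1 -> measurable D2 ->
  measurable_fun (D1 `*` D2) (fun z => K z.1 z.2) -> D2 y -> measurable_fun D1 (K ^~ y).
Proof.
move=> mD1 mD2 mK D2y.
apply: (@measurable_comp _ _ _ _ _ _ (D1 `*` D2) (fun z => K z.1 z.2) D1 (fun x => (x, y))) => //.
  exact: measurableX.
by move=> _ [x D1x <-].
exact: measurable_funTS (measurable_pair2 y).
Qed.

Variables (m1 : {sigma_finite_measure set T1 -> \bar R})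
          (m2 : {sigma_finite_measure set T2 -> \bar R}).
Variables (D1 : set T1) (D2 : set T2) (K : T1 -> T2 -> R).
Variables (f : T1 -> R) (g : T2 -> R) (M : R).
Hypotheses (mD1 : measurable D1) (mD2 : measurable D2).
Hypothesis mK : measurable_fun (D1 `*` D2) (fun z => K z.1 z.2).
Hypotheses (intf : m1.-integrable D1 (EFin \o f)) (intg : m2.-integrable D2 (EFin \o g)).
Hypothesis K_M : forall x y, D1 x -> D2 y -> `|K x y| <= M.

Lemma bounded_section_integrable x : D1 x ->
  m2.-integrable D2 (EFin \o fun y => g y * K x y).
Proof.
move=> D1x; apply: (@integrable_mul_bounded _ _ _ _ _ _ _ M) => //; last by move=> y; exact: K_M.
exact: measurable_section mK D1x.
Qed.

Lemma bounded_section_integrable2 y : D2 y ->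
  m1.-integrable D1 (EFin \o fun x => f x * K x y).
Proof.
move=> D2y; apply: (@integrable_mul_bounded _ _ _ _ _ _ _ M) => //; last by move=> x D1x; exact: K_M.
exact: measurable_section2 mK D2y.
Qed.

Let mf : measurable_fun D1 f.
Proof. by case/integrableP : intf => /measurable_EFinP. Qed.

Let mg : measurable_fun D2 g.
Proof. by case/integrableP : intg => /measurable_EFinP. Qed.

Let H x y := f x * (g y * K x y).

Let mH : measurable_fun (D1 `*` D2) (fun z => H z.1 z.2).
Proof.
apply: measurable_funM.
  apply: (@measurable_comp _ _ _ _ _ _ D1 f _ fst) => //.
    by move=> _ [[x y] [/= D1x _] <-].
  exact: measurable_funTS measurable_fst.
apply: measurable_funM => //.
apply: (@measurable_comp _ _ _ _ _ _ D2 g _ snd) => //.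
  by move=> _ [[x y] [/= _ D2y] <-].
exact: measurable_funTS measurable_snd.
Qed.

Let H1 x : D1 x -> m2.-integrable D2 (EFin \o H x).
Proof.
by move=> D1x; apply: integrable_EFinZl => //; exact: bounded_section_integrable.
Qed.

Let H2 y : D2 y -> m1.-integrable D1 (EFin \o H ^~ y).
Proof.
move=> D2y; apply: (eq_integrable _ (EFin \o fun x => g y * (f x * K x y))) => //.
  by move=> x _ /=; rewrite /H mulrCA.
by apply: integrable_EFinZl => //; exact: bounded_section_integrable2.
Qed.

Let G y := `|g y| * (M * \int[m1]_(x in D1) `|f x|).

Let intG : m2.-integrable D2 (EFin \o G).
Proof.
apply: (eq_integrable _ (EFin \o fun y => M * (\int[m1]_(x in D1) `|f x|) * `|g y|)) => //.
  by move=> y _ /=; rewrite /G mulrC.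
by apply: integrable_EFinZl => //; exact: (integrable_norm intg).
Qed.

Let H_G y : D2 y -> \int[m1]_(x in D1) `|H x y| <= G y.
Proof.
move=> D2y; rewrite /G mulrA -RintegralZl//; last exact: (integrable_norm intf).
apply: le_Rintegral => //; first exact: (integrable_norm (H2 D2y)).
  by apply: integrable_EFinZl => //; exact: (integrable_norm intf).
move=> x D1x; rewrite !normrM mulrC -mulrA -[leRHS]mulrA; apply: ler_wpM2l => //.
by apply: ler_wpM2r => //; exact: K_M.
Qed.

(** A bounded kernel between two integrable functions: the form of the Fubini theorem
for every exchange below in which the oscillating kernel is not itself integrable. *)
Lemma Rintegral_Fubini_bounded :
  \int[m1]_(x in D1) (f x * \int[m2]_(y in D2) (g y * K x y)) =
  \int[m2]_(y in D2) (g y * \int[m1]_(x in D1) (f x * K x y)).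
Proof.
transitivity (\int[m1]_(x in D1) \int[m2]_(y in D2) H x y).
  apply: eq_Rintegral => x /set_mem D1x; rewrite -RintegralZl//.
  exact: bounded_section_integrable.
rewrite (Rintegral_Fubini mD1 mD2 mH H1 H2 intG H_G).
apply: eq_Rintegral => y /set_mem D2y; rewrite -RintegralZl//.
  by apply: eq_Rintegral => x _; rewrite /H mulrCA.
exact: bounded_section_integrable2.
Qed.

Lemma bounded_section_Rintegral_le x : D1 x ->
  `|\int[m2]_(y in D2) (g y * K x y)| <= M * \int[m2]_(y in D2) `|g y|.
Proof.
move=> D1x; have iK := bounded_section_integrable D1x.
rewrite (le_trans (le_normr_Rintegral _ iK))// -RintegralZl//; last first.
  exact: (integrable_norm intg).
apply: le_Rintegral => //; first exact: (integrable_norm iK).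
  by apply: integrable_EFinZl => //; exact: (integrable_norm intg).
by move=> y D2y; rewrite normrM mulrC ler_wpM2r ?K_M.
Qed.

Lemma measurable_bounded_Rintegral :
  measurable_fun D1 (fun x => \int[m2]_(y in D2) (g y * K x y)).
Proof.
apply: measurable_Rintegral => //.
apply: measurable_funM => //.
apply: (@measurable_comp _ _ _ _ _ _ D2 g _ snd) => //.
  by move=> _ [[x y] [/= _ D2y] <-].
exact: measurable_funTS measurable_snd.
Qed.

End fubini_bounded.

(* The Fubini theorems above, for Lebesgue measure on the line.
   The sigma-algebra of a product of lines is attached to the type
   measurableTypeR R * measurableTypeR R, and stating the results for functions on
   R * R fixes this instance once and for all. *)
Section fubini_lebesgue.
Variable R : realType.
Notation mu := (@lebesgue_measure R).
Notation T := (measurableTypeR R).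
Variables (D1 D2 : set R) (K : R -> R -> R) (f g : R -> R) (M : R).
Hypotheses (mD1 : measurable D1) (mD2 : measurable D2).
Hypothesis mK : measurable_fun (D1 `*` D2) (fun z : R * R => K z.1 z.2).

Lemma measurable_Rintegral_lebesgue :
  measurable_fun D1 (fun x => \int[mu]_(y in D2) K x y).
Proof. exact (@measurable_Rintegral _ _ T T R mu D1 D2 K mD1 mD2 mK). Qed.

Hypotheses (intf : mu.-integrable D1 (EFin \o f)) (intg : mu.-integrable D2 (EFin \o g)).

Lemma measurable_bounded_Rintegral_lebesgue :
  measurable_fun D1 (fun x => \int[mu]_(y in D2) (g y * K x y)).
Proof. exact (@measurable_bounded_Rintegral _ _ T T R mu D1 D2 K g mD1 mD2 mK intg). Qed.

Hypothesis K_M : forall x y, D1 x -> D2 y -> `|K x y| <= M.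

Lemma bounded_Rintegral_le_lebesgue x : D1 x ->
  `|\int[mu]_(y in D2) (g y * K x y)| <= M * \int[mu]_(y in D2) `|g y|.
Proof.
exact (@bounded_section_Rintegral_le _ _ T T R mu D1 D2 K g M mD1 mD2 mK intg K_M x).
Qed.

Lemma Rintegral_Fubini_bounded_lebesgue :
  \int[mu]_(x in D1) (f x * \int[mu]_(y in D2) (g y * K x y)) =
  \int[mu]_(y in D2) (g y * \int[mu]_(x in D1) (f x * K x y)).
Proof.
exact (@Rintegral_Fubini_bounded _ _ T T R mu mu D1 D2 K f g M mD1 mD2 mK intf intg K_M).
Qed.

End fubini_lebesgue.

Section fubini_lebesgue_general.
Variable R : realType.
Notation mu := (@lebesgue_measure R).
Notation T := (measurableTypeR R).
Variables (D1 D2 : set R) (K : R -> R -> R) (G : R -> R).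
Hypotheses (mD1 : measurable D1) (mD2 : measurable D2).
Hypothesis mK : measurable_fun (D1 `*` D2) (fun z : R * R => K z.1 z.2).
Hypothesis K1 : forall x, D1 x -> mu.-integrable D2 (EFin \o K x).
Hypothesis K2 : forall y, D2 y -> mu.-integrable D1 (EFin \o K ^~ y).
Hypothesis intG : mu.-integrable D2 (EFin \o G).
Hypothesis K_G : forall y, D2 y -> \int[mu]_(x in D1) `|K x y| <= G y.

Lemma Rintegral_Fubini_lebesgue :
  [/\ mu.-integrable D1 (EFin \o fun x => \int[mu]_(y in D2) K x y),
      mu.-integrable D2 (EFin \o fun y => \int[mu]_(x in D1) K x y) &
      \int[mu]_(x in D1) (\int[mu]_(y in D2) K x y) =
      \int[mu]_(y in D2) (\int[mu]_(x in D1) K x y)].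
Proof.
split.
- exact (@Rintegral_Fubini_integrable _ _ T T R mu mu D1 D2 K G mD1 mD2 mK K1 K2 intG K_G).
- exact (@Rintegral_Fubini_integrable2 _ _ T T R mu mu D1 D2 K G mD1 mD2 mK K2 intG K_G).
- exact (@Rintegral_Fubini _ _ T T R mu mu D1 D2 K G mD1 mD2 mK K1 K2 intG K_G).
Qed.

End fubini_lebesgue_general.

(** * The Poisson kernel as an approximate identity *)

Section poisson.
Variable R : realType.
Notation mu := (@lebesgue_measure R).
Implicit Types (a b p s t u x : R).

Definition poisson p u : R := p / (p ^+ 2 + u ^+ 2).

Lemma poisson_den_gt0 p u : 0 < p -> 0 < p ^+ 2 + u ^+ 2.
Proof. by move=> p0; rewrite ltr_wpDr ?sqr_ge0 ?exprn_gt0. Qed.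

Lemma poisson_ge0 p u : 0 < p -> 0 <= poisson p u.
Proof. by move=> p0; rewrite divr_ge0 ?(ltW p0)// ltW ?poisson_den_gt0. Qed.

Lemma continuous_poisson p : 0 < p -> continuous (poisson p).
Proof.
move=> p0 x; apply: cvgMl_tmp; apply: cvgV; first by rewrite gt_eqF ?poisson_den_gt0.
apply: cvgD; first exact: cvg_cst.
by apply: (@cvgM _ _ _ _ id id); exact: cvg_id.
Qed.

Lemma continuous_poisson_shift p t : 0 < p -> continuous (fun s => poisson p (t - s)).
Proof.
move=> p0 s; apply: (@continuous_comp _ _ _ (fun s => t - s) (poisson p)).
  by apply: cvgB; [exact: cvg_cst|exact: cvg_id].
exact: continuous_poisson.
Qed.

Lemma continuous_integrable_oo a b (f : R -> R) : continuous f ->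
  mu.-integrable `]a, b[ (EFin \o f).
Proof.
move=> cf; apply: (@integrableS _ _ _ mu `[a, b]) => //; first exact: subset_itv_oo_cc.
apply: continuous_compact_integrable; first exact: segment_compact.
exact: continuous_subspaceT.
Qed.

Lemma poisson_integral a b p t : a < b -> 0 < p ->
  \int[mu]_(s in `]a, b[) poisson p (t - s) = atan ((b - t) / p) - atan ((a - t) / p).
Proof.
move=> ab p0; pose F s := atan ((s - t) / p).
have dF s : is_derive s 1 F (poisson p (t - s)).
  have h1 : is_derive s 1 (fun s => (s - t) / p) (p^-1).
    have h : is_derive s 1 (fun s => p^-1 * (s - t)) (p^-1 * (1 - 0)).
      exact: (is_deriveZ p^-1 (is_deriveB (is_derive_id s 1) (is_derive_cst t s 1))).
    apply: (is_derive_congr h); first by apply/funext => y; rewrite mulrC.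
    by rewrite subr0 mulr1.
  apply: (is_derive_congr (is_derive1_comp (is_derive1_atan _) h1)) => //.
  rewrite /poisson; field; rewrite !gt_eqF//=.
    by rewrite (_ : _ + _ = p ^+ 2 + (t - s) ^+ 2) ?gt_eqF ?poisson_den_gt0//; ring.
have ip := continuous_integrable_oo a b (@continuous_poisson_shift _ t p0).
have cF : continuous F by move=> s; exact: is_derive_continuous (dF s).
rewrite Rintegral_itv_obnd_cbnd; last first.
  exact: ip.
rewrite Rintegral_itv_bndo_bndc; last first.
  apply: (@integrableS _ _ _ mu `[a, b]) => //; first exact: subset_itv_co_cc.
  apply: continuous_compact_integrable; first exact: segment_compact.
  exact/continuous_subspaceT/continuous_poisson_shift.
rewrite /Rintegral (@continuous_FTC2 _ _ F) //.
- exact/continuous_subspaceT/continuous_poisson_shift.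
- split.
  + by move=> x _; have [] := dF x.
  + by apply: cvg_at_right_filter; exact: cF.
  + by apply: cvg_at_left_filter; exact: cF.
- by move=> x _; rewrite derive1E; have [_ ->] := dF x.
Qed.

Lemma poisson_integral_le a b p t : a < b -> 0 < p ->
  \int[mu]_(s in `]a, b[) poisson p (t - s) <= pi.
Proof.
move=> ab p0; rewrite poisson_integral//.
have := atan_ltpi2 ((b - t) / p); have := atan_gtNpi2 ((a - t) / p); lra.
Qed.

(** The widths of the Poisson kernels and the damping exponents run through one
sequence tending to 0, since dominated convergence is stated for sequences. *)
Definition eps (n : nat) : R := n.+1%:R^-1.

Lemma eps_gt0 n : 0 < eps n. Proof. by rewrite invr_gt0 ltr0n. Qed.

Lemma cvg_eps : eps n @[n --> \oo] --> (0 : R).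
Proof. exact: cvg_harmonic. Qed.

Lemma cvg_atan_eps (c : R) : 0 < c -> atan (c / eps n) @[n --> \oo] --> pi / 2.
Proof.
move=> c0; apply: (@cvg_comp _ _ _ (fun n => c / eps n) atan _ (pinfty_nbhs R));
  last exact: cvgy_atan.
apply/cvgryPge => M; have := nbhs_infty_ger (M / c); apply: filterS => n Mn.
rewrite /eps invrK mulrC -ler_pdivrMr// (le_trans Mn)// ler_nat.
exact: leqnSn.
Qed.

(** At an interior point both arcus tangents tend to pi/2 in absolute value, with
opposite signs. *)
Lemma cvg_poisson_integral_in a b t : a < t < b ->
  \int[mu]_(s in `]a, b[) poisson (eps n) (t - s) @[n --> \oo] --> (pi : R).
Proof.
move=> /andP[ta tb]; have E : pi = pi / 2 + pi / 2 :> R by field.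
rewrite [in X in _ --> X]E (_ : (fun n => _) =
    (fun n => atan ((b - t) / eps n) + atan ((t - a) / eps n))).
  by apply: cvgD; apply: cvg_atan_eps; rewrite subr_gt0.
apply/funext => n; rewrite (poisson_integral t (lt_trans ta tb) (eps_gt0 n)).
by rewrite -(opprB t a) mulNr atanN opprK.
Qed.

Lemma cvg_poisson_integral_out a b t : t < a -> a < b ->
  \int[mu]_(s in `]a, b[) poisson (eps n) (t - s) @[n --> \oo] --> (0 : R).
Proof.
move=> ta ab; under eq_fun => n do rewrite (poisson_integral t ab (eps_gt0 n)).
rewrite -(subrr (pi / 2)).
by apply: cvgB; apply: cvg_atan_eps; rewrite subr_gt0// (lt_trans ta).
Qed.

Variables (a b : R) (h : R -> R) (H : R).
Hypotheses (ab : a < b) (ch : continuous h) (h_H : forall x, `|h x| <= H).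

Lemma poisson_mul_integrable p t : 0 < p ->
  mu.-integrable `]a, b[ (EFin \o fun s => h s * poisson p (t - s)).
Proof.
move=> p0; apply: continuous_integrable_oo => x.
by apply: cvgM; [exact: ch|exact: continuous_poisson_shift].
Qed.

Lemma poisson_mul_le p t : 0 < p ->
  `|\int[mu]_(s in `]a, b[) (h s * poisson p (t - s))| <=
  H * \int[mu]_(s in `]a, b[) poisson p (t - s).
Proof.
move=> p0; have iP := continuous_integrable_oo a b (@continuous_poisson_shift _ t p0).
have ihP := poisson_mul_integrable t p0.
apply: le_trans (le_normr_Rintegral _ ihP) _ => //.
rewrite -RintegralZl//; apply: le_Rintegral => //.
- exact: (integrable_norm ihP).
- exact: integrable_EFinZl.
- move=> s _; rewrite normrM (ger0_norm (poisson_ge0 _ p0)).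
  by apply: ler_wpM2r => //; exact: poisson_ge0.
Qed.

Lemma cvg_poisson_out t : t < a ->
  \int[mu]_(s in `]a, b[) (h s * poisson (eps n) (t - s)) @[n --> \oo] --> (0 : R).
Proof.
move=> ta; have HP : H * \int[mu]_(s in `]a, b[) poisson (eps n) (t - s) @[n --> \oo] --> (0 : R).
  by rewrite -(mulr0 H); apply: cvgMl_tmp; exact: cvg_poisson_integral_out.
apply: (@squeeze_cvgr _ _ _ _ (fun n => - (H * \int[mu]_(s in `]a, b[) poisson (eps n) (t - s)))
  (fun n => H * \int[mu]_(s in `]a, b[) poisson (eps n) (t - s))) => //.
  by apply: nearW => n; rewrite -ler_norml; exact: poisson_mul_le (eps_gt0 n).
by rewrite -oppr0; exact: cvgN.
Qed.

(** Near t use continuity, and away from t use the bound on h.  A quadratic modulus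
suits the Poisson kernel, since (t - s)^2 poisson p (t - s) <= p. *)
Lemma quadratic_modulus t (e : R) : 0 < e ->
  exists2 K : R, 0 <= K & forall s, `|h s - h t| <= e + K * (t - s) ^+ 2.
Proof.
move=> e0; have /cvgrPdist_le /(_ _ e0) : h x @[x --> t] --> h t by exact: ch.
move=> /nbhs_ballP[d /= d0 hd].
have H0 : 0 <= H by rewrite (le_trans _ (h_H t)).
have K0 : 0 <= 2 * H / d ^+ 2 by rewrite divr_ge0 ?mulr_ge0 ?exprn_ge0// ltW.
exists (2 * H / d ^+ 2) => // s; have [ds|ds] := ltP (`|t - s|) d.
  rewrite distrC (le_trans (hd _ _))//.
  by rewrite lerDl mulr_ge0 ?sqr_ge0.
have h2 : `|h s - h t| <= 2 * H.
  by rewrite (le_trans (ler_normB _ _))//; have := h_H s; have := h_H t; lra.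
rewrite (le_trans h2)// -[leLHS]add0r lerD ?(ltW e0)//.
rewrite -mulrA ler_peMr ?mulr_ge0// mulrC ler_pdivlMr ?exprn_gt0// mul1r.
by rewrite -[leRHS]real_normK ?num_real// ler_pXn2r ?nnegrE ?(ltW d0).
Qed.

Lemma cvg_poisson_in t : a < t < b ->
  \int[mu]_(s in `]a, b[) (h s * poisson (eps n) (t - s)) @[n --> \oo] --> pi * h t.
Proof.
move=> atb.
have iP n := continuous_integrable_oo a b (@continuous_poisson_shift _ t (eps_gt0 n)).
have ihP n := poisson_mul_integrable t (eps_gt0 n).
have id n : mu.-integrable `]a, b[ (EFin \o fun s => (h s - h t) * poisson (eps n) (t - s)).
  apply: continuous_integrable_oo => x.
  apply: cvgM; last exact: continuous_poisson_shift (eps_gt0 n) _.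
  by apply: cvgB; [exact: ch|exact: cvg_cst].
have d0 : \int[mu]_(s in `]a, b[) ((h s - h t) * poisson (eps n) (t - s))
    @[n --> \oo] --> (0 : R).
  apply/cvgrPdist_le => e e0; have pi0 := pi_gt0 R.
  have e1 : 0 < e / (2 * pi) by rewrite divr_gt0// mulr_gt0.
  have [K K0 hK] := quadratic_modulus t e1.
  have l0 : K * (b - a) * eps n @[n --> \oo] --> (0 : R).
    by rewrite -(mulr0 (K * (b - a))); apply: cvgMl_tmp; exact: cvg_eps.
  have e2 : 0 < e / 2 by rewrite divr_gt0.
  move/cvgrPdist_le : l0 => /(_ _ e2); apply: filterS => n.
  have en := eps_gt0 n.
  rewrite !sub0r !normrN ger0_norm; last first.
    by rewrite !mulr_ge0 ?(ltW en)// subr_ge0 ltW.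
  move=> Kn; rewrite (le_trans (le_normr_Rintegral _ (id n)))//.
  (* The first term integrates to at most e/2, the second one to K (b - a) eps n. *)
  pose B s := e / (2 * pi) * poisson (eps n) (t - s) + K * eps n.
  have iB : mu.-integrable `]a, b[ (EFin \o B).
    apply: continuous_integrable_oo => x; apply: cvgD; last exact: cvg_cst.
    by apply: cvgMl_tmp; exact: continuous_poisson_shift (eps_gt0 n) _.
  apply: (@le_trans _ _ (\int[mu]_(s in `]a, b[) B s)).
    apply: le_Rintegral => //; first exact: (integrable_norm (id n)).
    move=> s _; rewrite normrM (ger0_norm (poisson_ge0 _ en)).
    apply: (@le_trans _ _ ((e / (2 * pi) + K * (t - s) ^+ 2) * poisson (eps n) (t - s))).
      by apply: ler_wpM2r => //; exact: poisson_ge0.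
    rewrite mulrDl lerD2l -mulrA; apply: ler_wpM2l => //.
    rewrite /poisson mulrCA ler_piMr ?(ltW en)//.
    rewrite ler_pdivrMr ?poisson_den_gt0// mul1r lerDr sqr_ge0//.
  have iK : mu.-integrable `]a, b[ (EFin \o fun=> K * eps n).
    by apply: continuous_integrable_oo => x; exact: cvg_cst.
  rewrite RintegralD//; last exact: integrable_EFinZl.
  rewrite (RintegralZl _ _ (iP n))// Rintegral_cst//.
  have mab : fine (mu `]a, b[) = b - a.
    by rewrite lebesgue_measure_itv/= lte_fin ab.
  rewrite [fine _]mab.
  rewrite [leRHS](_ : e = e / (2 * pi) * pi + e / 2); last first.
    by move: pi0; generalize (pi : R) => q q0; field; rewrite gt_eqF.
  rewrite lerD//; last by rewrite mulrAC.
  apply: ler_wpM2l; [exact: ltW|exact: poisson_integral_le].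
have E n : \int[mu]_(s in `]a, b[) (h s * poisson (eps n) (t - s)) =
   \int[mu]_(s in `]a, b[) ((h s - h t) * poisson (eps n) (t - s)) +
   h t * \int[mu]_(s in `]a, b[) poisson (eps n) (t - s).
  rewrite -RintegralZl// -RintegralD//; last exact: integrable_EFinZl.
  by apply: eq_Rintegral => s _; rewrite -mulrDl subrK.
have Eh : pi * h t = 0 + h t * pi by rewrite add0r mulrC.
rewrite Eh (funext E); apply: cvgD => //.
by apply: cvgMl_tmp; exact: cvg_poisson_integral_in.
Qed.

End poisson.

(** * Bounded continuous functions are dense in L2 of an interval *)

Section density.
Variable R : realType.
Notation mu := (@lebesgue_measure R).
Implicit Types (M u v : R).

Definition clip M u : R := Order.max (- M) (Order.min u M).

Lemma clip_le M u : 0 <= M -> `|clip M u| <= M.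
Proof.
move=> M0; rewrite ler_norml /clip le_max lexx/= ge_max ge_min lexx orbT andbT.
by rewrite ge0_cp.
Qed.

Lemma clip_id M u : `|u| <= M -> clip M u = u.
Proof.
rewrite ler_norml => /andP[h1 h2]; rewrite /clip (min_idPl h2).
exact/max_idPr.
Qed.

Lemma clip_lipschitz M u v : `|clip M u - clip M v| <= `|u - v|.
Proof.
have h1 := ler_norm (u - v); have h2 := ler_norm (v - u).
rewrite -(distrC u v) in h2.
rewrite /clip; case: (leP u M) => uM; case: (leP v M) => vM;
  case: (leP (- M) u) => h3; case: (leP (- M) v) => h4; case: (leP (- M) M) => h5;
  rewrite ler_norml; apply/andP; split; lra.
Qed.

Lemma clip_diff_le M u : 0 <= M -> `|u - clip M u| <= `|u|.
Proof.
move=> M0; have h1 := ler_norm u; have h2 := ler_norm (- u).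
rewrite normrN in h2.
rewrite /clip; case: (leP u M) => uM; case: (leP (- M) u) => h3;
  case: (leP (- M) M) => h4; rewrite ler_norml; apply/andP; split; lra.
Qed.

Lemma continuous_clip M : continuous (clip M).
Proof.
move=> u; apply/cvgrPdist_le => e e0.
have /cvgrPdist_le /(_ _ e0) : v @[v --> u] --> u by exact: cvg_id.
by apply: filterS => v; exact: le_trans (clip_lipschitz _ _ _).
Qed.

Variables (a b : R) (f : R -> R).
Notation I := `]a, b[%classic.
Hypotheses (mf : measurable_fun I f) (intf2 : mu.-integrable I (EFin \o fun x => f x ^+ 2)).

Lemma measurable_clip M : measurable_fun I (fun x => clip M (f x)).
Proof.
apply: measurableT_comp => //; apply: continuous_measurable_fun.
exact: continuous_clip.
Qed.

Lemma bounded_integrable_oo (g : R -> R) M : measurable_fun I g ->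
  (forall x, `|g x| <= M) -> mu.-integrable I (EFin \o g).
Proof.
move=> mg gM; have i1 : mu.-integrable I (EFin \o fun=> 1).
  by apply: continuous_integrable_oo => x; exact: cvg_cst.
have := @integrable_mul_bounded _ _ _ mu I g (fun=> 1) M _ mg i1 (fun x _ => gM x).
move=> /(_ (measurable_itv _)); apply: eq_integrable => // x _ /=.
by rewrite mul1r.
Qed.

Lemma square_integrable_integrable : mu.-integrable I (EFin \o f).
Proof.
have i1 : mu.-integrable I (EFin \o fun=> 1).
  by apply: continuous_integrable_oo => x; exact: cvg_cst.
apply: integrable_dominated (integrable_EFinD _ i1 intf2) _ => // x _.
rewrite ler_norml; apply/andP; split.
  by have := sqr_ge0 (f x + 1); have := sqr_ge0 (f x - 1); nra.
by have := sqr_ge0 (f x + 1); have := sqr_ge0 (f x - 1); nra.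
Qed.

(** Dominated convergence with dominating function f^2. *)
Lemma clip_dense (e : R) : 0 < e -> exists2 k : nat, (0 < k)%N &
  mu.-integrable I (EFin \o fun x => (f x - clip k%:R (f x)) ^+ 2) /\
  \int[mu]_(x in I) (f x - clip k%:R (f x)) ^+ 2 <= e.
Proof.
move=> e0.
have mg n : measurable_fun I (fun x => (f x - clip n.+1%:R (f x)) ^+ 2).
  by apply: measurable_funX; apply: measurable_funB => //; exact: measurable_clip.
have bd (n : nat) x : `|(f x - clip n.+1%:R (f x)) ^+ 2| <= f x ^+ 2.
  have h : `|f x - clip n.+1%:R (f x)| <= `|f x|.
    exact: clip_diff_le.
  by rewrite ger0_norm ?sqr_ge0// -(real_normK (num_real _)) -[leRHS](real_normK (num_real _))
    ler_pXn2r ?nnegrE.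
have [||||_ L] := @Rintegral_dominated_cvg _ _ _ mu I
  (fun n x => (f x - clip n.+1%:R (f x)) ^+ 2) (fun=> 0) (fun x => f x ^+ 2) (measurable_itv _).
- exact: mg.
- move=> x _; apply: cvg_near_cst.
  have := nbhs_infty_ger `|f x|; apply: filterS => n fn.
  rewrite clip_id ?subrr ?expr0n//.
  by rewrite (le_trans fn)// ler_nat.
- exact: intf2.
- by move=> n x _; exact: bd.
have {}L : \int[mu]_(x in I) (f x - clip n.+1%:R (f x)) ^+ 2 @[n --> \oo] --> (0 : R).
  by move: L; rewrite Rintegral_cst ?mul0r.
move/cvgrPdist_le : L => /(_ _ e0)[n _ /(_ n (leqnn n))].
rewrite sub0r normrN => h.
exists n.+1 => //; split; last exact: le_trans (ler_norm _) h.
apply: integrable_dominated intf2 _; [by []|exact: mg|by move=> x _; exact: bd].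
Qed.

(** Truncate f at height k, approximate the truncation in L1 by a continuous
function and truncate the latter too.  For functions bounded by k the square of
the difference is at most 2k times its absolute value, so closeness in L1 gives
closeness in L2.  The bound of the approximant is what dominates its Poisson integrals. *)
Lemma continuous_dense_L2 (e : R) : 0 < e -> exists2 h : R -> R,
  continuous h /\ (exists M, forall x, `|h x| <= M) &
  mu.-integrable I (EFin \o fun x => (f x - h x) ^+ 2) /\
  \int[mu]_(x in I) (f x - h x) ^+ 2 <= e.
Proof.
move=> e0; have e4 : 0 < e / 4 by rewrite divr_gt0.
have [k k0 [ik Ik]] := clip_dense e4.
have M0 : 0 < k%:R :> R by rewrite ltr0n.
set M : R := k%:R in M0 ik Ik.
pose fk x := clip M (f x).
have fkM x : `|fk x| <= M by exact/clip_le/ltW.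
have ifk : mu.-integrable I (EFin \o fk).
  by apply: bounded_integrable_oo fkM; exact: measurable_clip.
have Ifin : (mu I < +oo)%E by rewrite lebesgue_measure_itv/=; case: ifP => _; rewrite ?ltry.
have [g [cg ig lg]] := approximation_continuous_integrable (measurable_itv _) Ifin ifk.
have d0 : 0 < e / (8 * M) by rewrite divr_gt0// mulr_gt0.
have {}lg : \int[mu]_(x in I) `|fk x - g n x| @[n --> \oo] --> (0 : R).
  exact: (fine_fcvg lg).
move/cvgrPdist_le : lg => /(_ _ d0)[n _ /(_ n (leqnn n))].
rewrite sub0r normrN => hn.
have ifg : mu.-integrable I (EFin \o fun x => `|fk x - g n x|).
  have i1 : mu.-integrable I (EFin \o fun x => fk x - g n x) by exact: integrable_EFinB.
  exact: (integrable_norm i1).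
have Ifg : \int[mu]_(x in I) `|fk x - g n x| <= e / (8 * M).
  exact: le_trans (ler_norm _) hn.
pose h x := clip M (g n x).
have hM x : `|h x| <= M by exact/clip_le/ltW.
have ch : continuous h.
  by move=> x; apply: (@continuous_comp _ _ _ (g n) (clip M)); [exact: cg|exact: continuous_clip].
have mh : measurable_fun I h by apply: measurable_funTS; exact: continuous_measurable_fun.
have fkh x : (fk x - h x) ^+ 2 <= 2 * M * `|fk x - g n x|.
  have h1 : `|fk x - h x| <= `|fk x - g n x|.
    by rewrite -{1}(clip_id (fkM x)); exact: clip_lipschitz.
  have h2 : `|fk x - h x| <= 2 * M.
    by rewrite (le_trans (ler_normB _ _))//; have := fkM x; have := hM x; lra.
  by rewrite -real_normK ?num_real// expr2 ler_pM.
have bd x : `|(f x - h x) ^+ 2| <= 2 * (f x - fk x) ^+ 2 + 2 * (2 * M * `|fk x - g n x|).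
  rewrite ger0_norm ?sqr_ge0//; have := fkh x; have := sqr_ge0 (f x - fk x - (fk x - h x)).
  nra.
have ib1 : mu.-integrable I (EFin \o fun x => 2 * (f x - fk x) ^+ 2) by exact: integrable_EFinZl.
have ib3 : mu.-integrable I (EFin \o fun x => 2 * M * `|fk x - g n x|) by exact: integrable_EFinZl.
have ib2 : mu.-integrable I (EFin \o fun x => 2 * (2 * M * `|fk x - g n x|)) by exact: integrable_EFinZl.
have ib : mu.-integrable I (EFin \o fun x => 2 * (f x - fk x) ^+ 2 + 2 * (2 * M * `|fk x - g n x|)).
  exact: integrable_EFinD.
have ih : mu.-integrable I (EFin \o fun x => (f x - h x) ^+ 2).
  apply: integrable_dominated ib (fun x _ => bd x) => //.
  by apply: measurable_funX; exact: measurable_funB.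
exists h; first by split => //; exists M.
split => //.
apply: (@le_trans _ _ (\int[mu]_(x in I) (2 * (f x - fk x) ^+ 2 + 2 * (2 * M * `|fk x - g n x|)))).
  by apply: le_Rintegral => // x _; exact: le_trans (ler_norm _) (bd x).
rewrite (RintegralD _ ib1 ib2)// (RintegralZl _ _ ik)// (RintegralZl _ _ ib3)// (RintegralZl _ _ ifg)//.
(* By (x + y)^2 <= 2 x^2 + 2 y^2, each of the two errors contributes e/2. *)
have -> : e = 2 * (e / 4) + 2 * (2 * M * (e / (8 * M))) by field; rewrite gt_eqF.
apply: lerD; apply: ler_wpM2l => //; apply: ler_wpM2l => //.
by rewrite mulr_ge0// ltW.
Qed.

End density.

(** * Exponential weights and expanding kernels *)

Section exponential_weights.
Variable R : realType.
Notation mu := (@lebesgue_measure R).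
Notation D := (@Rplus R).
Implicit Types (f : R -> R) (a b p q s t x : R).

Hint Extern 0 (measurable (@Rplus _)) => solve [exact: measurable_itv] : core.

Lemma measurable_mul2 (A B : set R) (k : R -> R) : continuous k ->
  measurable_fun (A `*` B) (fun z : R * R => k (z.1 * z.2)).
Proof.
move=> ck; apply: measurable_funTS; apply: measurableT_comp => //.
  exact: continuous_measurable_fun.
by apply: measurable_funM.
Qed.

(** Transforms of integrable functions are bounded but not integrable; the weight
exp(-p x) makes them so. *)
Lemma damped_integrable p (k : R -> R) (C : R) : 0 < p -> measurable_fun D k ->
  (forall x, 0 < x -> `|k x| <= C) ->
  mu.-integrable D (EFin \o fun x => expR (- (p * x)) * k x).
Proof.
move=> p0 mk kC; have [ie _] := exp_integral p0.
by apply: (@integrable_mul_bounded _ _ _ _ _ _ _ C) => // x; rewrite RplusE; exact: kC.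
Qed.

Lemma measurable_expRN2 (A : set (R * R)) (k : R * R -> R) : measurable_fun A k ->
  measurable_fun A (fun z => expR (- k z)).
Proof.
move=> mk; apply: (measurableT_comp (f := expR)); first exact: measurable_expR.
exact: measurableT_comp.
Qed.

Lemma measurable_expR_affine (A : set R) (x c d : R) :
  measurable_fun A (fun y => expR (- (x * (c + d * y)))).
Proof.
apply: measurable_funTS; apply: measurableT_comp; first exact: measurable_expR.
apply: measurableT_comp => //; apply: measurable_funM => //.
by apply: measurable_funD => //; exact: measurable_funM.
Qed.

Lemma sin_density_integral : mu.-integrable D (EFin \o @sin_density R) /\
  \int[mu]_(x in D) sin_density x = pi / 2.
Proof.
have [h1 h2] := lorentz_integral (@ltr01 R) (@ltr01 R).
have E x : 1 / (1 ^+ 2 + (1 * x) ^+ 2) = sin_density x :> R.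
  by rewrite /sin_density expr1n !mul1r.
split; first by apply: eq_integrable h1 => // x _; rewrite /= E.
rewrite divr1 in h2; rewrite -h2.
by apply: eq_Rintegral => x _; rewrite E.
Qed.

(** The integral operator with kernel k, multiplied by sqrt (2/pi), does not decrease
the L2 norm of a function supported in ]a, b[.  The closed interval is the one over
which the truncated integrals of the equations are taken; the open one is where
Poisson integrals converge to the value of the function. *)
Definition expanding (k : R -> R -> R) := forall a b f, 0 < a -> a < b ->
  measurable_fun D f -> mu.-integrable D (EFin \o fun x => f x ^+ 2) ->
  measurable_fun D (fun x => \int[mu]_(t in `[a, b]) (k x t * f t)) /\
  ((pi / 2 * \int[mu]_(t in `]a, b[) f t ^+ 2)%:E <=
   \int[mu]_(x in D) ((\int[mu]_(t in `[a, b]) (k x t * f t)) ^+ 2)%:E)%E.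

Lemma Rintegral_itv_cc_oo a b f : measurable_fun `[a, b] f ->
  \int[mu]_(t in `[a, b]) f t = \int[mu]_(t in `]a, b[) f t.
Proof.
move=> mf; rewrite /Rintegral.
have m1 : measurable_fun `]a, b[ (EFin \o f).
  by apply/measurable_EFinP; apply: measurable_funS mf => //; exact: subset_itv_oo_cc.
have m2 : measurable_fun `[a, b[ (EFin \o f).
  by apply/measurable_EFinP; apply: measurable_funS mf => //; exact: subset_itv_co_cc.
by rewrite [in RHS]integral_itv_obnd_cbnd// integral_itv_bndo_bndc.
Qed.

Lemma subset_Rplus a b : 0 < a -> `[a, b] `<=` D.
Proof.
move=> a0 x /=; rewrite in_itv/= => /andP[ax _]; rewrite RplusE.
exact: lt_le_trans ax.
Qed.

End exponential_weights.

(** * Kernels that are the sum of an oscillating and a Laplace part *)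

Section kernel_transform.
Variable R : realType.
Notation mu := (@lebesgue_measure R).
Notation D := (@Rplus R).
Implicit Types (f g h : R -> R) (a b p q s t x : R).

Hint Extern 0 (measurable (@Rplus _)) => solve [exact: measurable_itv] : core.

(* The cosine and the sine kernel are treated together.  The oscillating part e is
   cos or sin, sg = 1 or -1 is the sign of the reflected Poisson kernel, m is the
   density whose Laplace transform is the other part of the kernel, and r p t is the
   Laplace transform of x |-> e(x t) at p.  The last hypothesis contains what links
   e to m: the inner transform of m gives the kernel (pi/2) / (s + t). *)
Variables (e m : R -> R) (r : R -> R -> R) (sg : R).
Hypotheses (ce : continuous e) (e_le1 : forall x, `|e x| <= 1) (sg_le1 : `|sg| <= 1).
Hypothesis ee : forall p t s, 0 < p ->
  \int[mu]_(x in D) (expR (- (p * x)) * e (x * t) * e (x * s)) =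
  (poisson p (t - s) + sg * poisson p (- t - s)) / 2.
Hypotheses (cm : continuous m) (m_ge0 : forall x, 0 < x -> 0 <= m x)
  (m_le1 : forall x, 0 < x -> `|m x| <= 1).
Hypothesis er : forall p t, 0 < p ->
  \int[mu]_(x in D) (expR (- (p * x)) * e (x * t)) = r p t.
Hypothesis mr : measurable_fun setT (fun z : R * R => r z.1 z.2).
Hypothesis cr : forall p t, 0 < p -> {for p, continuous (r ^~ t)}.
Hypothesis m_r : forall (a : R) p s t x, 0 < a -> a <= s -> a <= t -> 0 <= p -> 0 < x ->
  `|m x * r (p + s * x) t| <= a^-1 * sin_density x.
Hypothesis m_inv : forall (a : R) p s x, 0 < a -> a <= s -> 0 < p -> 0 < x ->
  m x / (p + s * x) <= (a^-1 + p^-1) * sin_density x.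
Hypothesis m_r0 : forall s t, 0 < s -> 0 < t -> s != t ->
  \int[mu]_(x in D) (m x * r (s * x) t) = pi / 2 / (s + t).

Lemma measurable_emul t : measurable_fun D (fun x => e (x * t)).
Proof.
apply: measurable_funTS; apply: measurableT_comp; first exact: continuous_measurable_fun.
by apply: measurable_funM.
Qed.

Let mm : measurable_fun D m.
Proof. exact: measurable_continuous_Rplus. Qed.

Lemma laplace_integrable p : 0 < p ->
  mu.-integrable D (EFin \o fun x => m x * expR (- (p * x))).
Proof.
move=> p0; have [h _] := pow_expRN_integrable 0 mm m_le1 p0.
by apply: eq_integrable h => // x _; rewrite /= expr0 mul1r.
Qed.

Lemma laplace_le p : 0 < p -> `|laplace m p| <= 2 / p.
Proof.
move=> p0; have [_] := pow_expRN_integrable 0 mm m_le1 p0.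
rewrite fact0 mul1r expr1; congr (`|_| <= _).
by apply: eq_Rintegral => x _; rewrite expr0 mul1r.
Qed.

Lemma laplace_ge0 p : 0 <= laplace m p.
Proof.
apply: Rintegral_ge0 => x; rewrite RplusE => x0.
by rewrite mulr_ge0 ?expR_ge0 ?m_ge0.
Qed.

Lemma measurable_laplace : measurable_fun D (laplace m).
Proof.
apply: (measurable_Rintegral_lebesgue (K := fun p x => m x * expR (- (p * x)))) => //.
apply: measurable_funTS; apply: measurable_funM.
  by apply: measurableT_comp => //; exact: continuous_measurable_fun.
by apply: measurable_expRN2; exact: measurable_funM.
Qed.

(** The bound 1/p is the integral of exp(-p x). *)
Lemma r_le p t : 0 < p -> `|r p t| <= p^-1.
Proof.
move=> p0; have [ie Ie] := exp_integral p0; rewrite -er// -Ie.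
have iE : mu.-integrable D (EFin \o fun x => expR (- (p * x)) * e (x * t)).
  by apply: (@damped_integrable _ _ _ 1) => //; exact: measurable_emul.
apply: le_trans (le_normr_Rintegral _ iE) _ => //.
apply: le_Rintegral => //; first exact: (integrable_norm iE).
by move=> x _; rewrite normrM ger0_norm ?expR_ge0// ler_piMr ?expR_ge0.
Qed.

Section interval.
Variables (a b : R).
Hypotheses (a0 : 0 < a) (ab : a < b).
Notation I := `]a, b[%classic.

Let I_ge s : I s -> a <= s.
Proof. by rewrite /= in_itv/= => /andP[/ltW]. Qed.

Let I_gt0 s : I s -> 0 < s.
Proof. by move=> /I_ge; exact: lt_le_trans. Qed.

Definition trig_transform f x := \int[mu]_(t in I) (f t * e (x * t)).

Let mE A B : measurable_fun (A `*` B) (fun z : R * R => e (z.1 * z.2)).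
Proof. exact: measurable_mul2. Qed.

Lemma measurable_trig_transform f : mu.-integrable I (EFin \o f) ->
  measurable_fun D (trig_transform f).
Proof.
move=> intf.
apply: (measurable_bounded_Rintegral_lebesgue (K := fun x t => e (x * t))) => //.
Qed.

Lemma trig_transform_le f x : mu.-integrable I (EFin \o f) -> 0 < x ->
  `|trig_transform f x| <= \int[mu]_(t in I) `|f t|.
Proof.
rewrite -RplusE => intf Dx; rewrite -[leRHS]mul1r.
by apply: (bounded_Rintegral_le_lebesgue (K := fun x t => e (x * t)) _ _ (@mE _ _) intf _ Dx).
Qed.

Lemma damped_trig_integrable p f g : 0 < p -> mu.-integrable I (EFin \o f) ->
  mu.-integrable I (EFin \o g) ->
  mu.-integrable D (EFin \o fun x => expR (- (p * x)) * (trig_transform f x * trig_transform g x)).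
Proof.
move=> p0 intf intg.
apply: (@damped_integrable _ _ _ ((\int[mu]_(t in I) `|f t|) * (\int[mu]_(t in I) `|g t|))) => //.
  by apply: measurable_funM; exact: measurable_trig_transform.
by move=> x x0; rewrite normrM ler_pM// trig_transform_le.
Qed.

Definition trig_kernel p t s : R := (poisson p (t - s) + sg * poisson p (- t - s)) / 2.

(** Fubini twice: once for each of the two transforms, each time against an integrable
function of x that contains the weight. *)
Lemma damped_trig_product p f g : 0 < p -> mu.-integrable I (EFin \o f) ->
  mu.-integrable I (EFin \o g) ->
  \int[mu]_(x in D) (expR (- (p * x)) * (trig_transform f x * trig_transform g x)) =
  \int[mu]_(t in I) (f t * \int[mu]_(s in I) (g s * trig_kernel p t s)).
Proof.
move=> p0 intf intg.
have ig : mu.-integrable D (EFin \o fun x => expR (- (p * x)) * trig_transform g x).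
  apply: damped_integrable => //; first exact: measurable_trig_transform.
  by move=> x x0; exact: trig_transform_le.
have eM x y : D x -> I y -> `|e (x * y)| <= 1 by move=> _ _; exact: e_le1.
transitivity (\int[mu]_(x in D) ((expR (- (p * x)) * trig_transform g x) * trig_transform f x)).
  by apply: eq_Rintegral => x _; rewrite -mulrA; congr (_ * _); rewrite mulrC.
rewrite (Rintegral_Fubini_bounded_lebesgue (D1 := D) (K := fun x t => e (x * t))
  (measurable_itv _) (measurable_itv _) (@mE _ _) ig intf eM).
apply: eq_Rintegral => t _; congr (_ * _).
have it : mu.-integrable D (EFin \o fun x => expR (- (p * x)) * e (x * t)).
  apply: (@damped_integrable _ _ _ 1) => //; exact: measurable_emul.
transitivity (\int[mu]_(x in D) ((expR (- (p * x)) * e (x * t)) * trig_transform g x)).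
  by apply: eq_Rintegral => x _; rewrite mulrAC.
rewrite (Rintegral_Fubini_bounded_lebesgue (D1 := D) (K := fun x t => e (x * t))
  (measurable_itv _) (measurable_itv _) (@mE _ _) it intg eM).
by apply: eq_Rintegral => s _; rewrite ee.
Qed.

Section trig_limit.
Variables (h : R -> R) (H : R).
Hypotheses (ch : continuous h) (h_H : forall x, `|h x| <= H).

Lemma trig_kernel_split p t : 0 < p ->
  \int[mu]_(s in I) (h s * trig_kernel p t s) =
  2^-1 * \int[mu]_(s in I) (h s * poisson p (t - s)) +
  sg / 2 * \int[mu]_(s in I) (h s * poisson p (- t - s)).
Proof.
move=> p0; have i1 := poisson_mul_integrable a b ch t p0.
have i2 := poisson_mul_integrable a b ch (- t) p0.
rewrite -!RintegralZl// -RintegralD//; [|exact: integrable_EFinZl..].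
by apply: eq_Rintegral => s _; rewrite /trig_kernel; field.
Qed.

(** Both Poisson integrals are at most pi times the bound of h, and each of them
carries the factor 1/2. *)
Lemma trig_kernel_le p t : 0 < p ->
  `|\int[mu]_(s in I) (h s * trig_kernel p t s)| <= H * pi.
Proof.
move=> p0; rewrite trig_kernel_split//.
have H0 : 0 <= H by rewrite (le_trans _ (h_H 0)).
have B u : `|\int[mu]_(s in I) (h s * poisson p (u - s))| <= H * pi.
  apply: le_trans (poisson_mul_le a b ch h_H u p0) _.
  by apply: ler_wpM2l => //; exact: poisson_integral_le.
rewrite (le_trans (ler_normD _ _))// !normrM.
have n2 : `|2^-1 : R| = 2^-1 by rewrite ger0_norm ?invr_ge0.
rewrite n2; have h1 := B t; have h2 := B (- t).
set A1 := `|_| in h1 *; set A2 := `|\int[mu]_(s in I) (h s * poisson p (- t - s))| in h2 *.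
have h3 : `|sg| * 2^-1 * A2 <= 2^-1 * A2.
  by apply: ler_wpM2r; rewrite ?normr_ge0// ler_piMl// invr_ge0.
lra.
Qed.

(** The reflected kernel is centred at -t, outside ]a, b[, and contributes nothing:
this is where a > 0 matters. *)
Lemma cvg_trig_kernel t : a < t < b ->
  \int[mu]_(s in I) (h s * trig_kernel (eps R n) t s) @[n --> \oo] --> pi / 2 * h t.
Proof.
move=> atb; have E n := trig_kernel_split t (eps_gt0 R n).
have Eh : pi / 2 * h t = 2^-1 * (pi * h t) + sg / 2 * 0 by rewrite mulr0 addr0; ring.
rewrite Eh (funext E); apply: cvgD; apply: cvgMl_tmp.
  exact: (cvg_poisson_in ab ch h_H atb).
apply: (cvg_poisson_out ab ch h_H); have /andP[at_ _] := atb.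
by rewrite (lt_trans _ a0)// oppr_lt0 (lt_trans a0).
Qed.

Lemma measurable_poisson2 p (c : R) : 0 < p ->
  measurable_fun setT (fun z : R * R => poisson p (c * z.1 - z.2)).
Proof.
move=> p0; apply: (measurableT_comp (f := poisson p)).
  exact: continuous_measurable_fun (continuous_poisson p0).
by apply: measurable_funB => //; exact: measurable_funM.
Qed.

(** Parseval's formula, up to the factor pi/2 of the transforms that are not
normalized. *)
Lemma cvg_damped_trig_product f : mu.-integrable I (EFin \o f) ->
  \int[mu]_(x in D) (expR (- (eps R n * x)) * (trig_transform f x * trig_transform h x))
    @[n --> \oo] --> pi / 2 * \int[mu]_(t in I) (f t * h t).
Proof.
move=> intf; have inth := continuous_integrable_oo a b ch.
rewrite (funext (fun n => damped_trig_product (eps_gt0 R n) intf inth)).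
have mf : measurable_fun I f by case/integrableP : intf => /measurable_EFinP.
have [||||_ L] := @Rintegral_dominated_cvg _ _ _ mu I
  (fun n t => f t * \int[mu]_(s in I) (h s * trig_kernel (eps R n) t s))
  (fun t => f t * (pi / 2 * h t)) (fun t => H * pi * `|f t|) (measurable_itv _).
- move=> n; apply: measurable_funM => //.
  apply: (measurable_bounded_Rintegral_lebesgue (K := trig_kernel (eps R n)) _ _ _ inth) => //.
  apply: measurable_funTS; apply: measurable_funM => //; apply: measurable_funD.
    rewrite (_ : (fun z => _) = fun z : R * R => poisson (eps R n) (1 * z.1 - z.2)).
      exact: measurable_poisson2 (eps_gt0 R n).
    by apply/funext => z; rewrite mul1r.
  apply: measurable_funM => //.
  rewrite (_ : (fun z => _) = fun z : R * R => poisson (eps R n) (- 1 * z.1 - z.2)).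
    exact: measurable_poisson2 (eps_gt0 R n).
  by apply/funext => z; rewrite mulN1r.
- move=> x Ix; apply: cvgMl_tmp; apply: cvg_trig_kernel.
  by move: Ix; rewrite /= in_itv/=.
- by apply: integrable_EFinZl => //; exact: (integrable_norm intf).
- move=> n t It; rewrite normrM mulrC; apply: ler_wpM2r => //.
  exact: trig_kernel_le (eps_gt0 R n).
rewrite -RintegralZl//; last first.
  apply: (@integrable_mul_bounded _ _ _ _ _ _ _ H) => //.
  by apply: measurable_funTS; exact: continuous_measurable_fun.
rewrite (_ : \int[mu]_(x in I) (pi / 2 * (f x * h x)) =
  \int[mu]_(x in I) (f x * (pi / 2 * h x))) //.
by apply: eq_Rintegral => x _; rewrite mulrCA.
Qed.

End trig_limit.

Lemma measurable_laplace2 :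
  measurable_fun (D `*` I) (fun z : R * R => laplace m (z.1 * z.2)).
Proof.
apply: (measurable_comp (F := D) (f := laplace m)) => //.
- move=> _ [[x s] [/= Dx Is] <-]; move: Dx; rewrite !RplusE => Dx.
  by rewrite mulr_gt0// I_gt0.
- exact: measurable_laplace.
- by apply: measurable_funTS; exact: measurable_funM.
Qed.

Definition laplace_transform f x := \int[mu]_(s in I) (f s * laplace m (x * s)).

(** Writes the Laplace transform as an integral over y and exchanges it with the
integral over x.  The integral of exp(-(p + s y) x) over x is 1/(p + s y), and
m(y)/(p + s y) is O(1/y^2), as the integrable bound [G] requires. *)
Lemma damped_laplace_Fubini p s (k : R -> R) (A : R) : 0 < p -> I s ->
  measurable_fun D k -> (forall x, 0 < x -> `|k x| <= A) ->
  [/\ mu.-integrable D (EFin \o fun x => expR (- (p * x)) * (k x * laplace m (x * s))),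
      mu.-integrable D (EFin \o fun y =>
        m y * \int[mu]_(x in D) (expR (- ((p + s * y) * x)) * k x)) &
      \int[mu]_(x in D) (expR (- (p * x)) * (k x * laplace m (x * s))) =
      \int[mu]_(y in D) (m y * \int[mu]_(x in D) (expR (- ((p + s * y) * x)) * k x))].
Proof.
move=> p0 Is mk kA; have s0 := I_gt0 Is.
pose K x y := expR (- (p * x)) * k x * (m y * expR (- (x * s * y))).
have KE x y : K x y = m y * (expR (- ((p + s * y) * x)) * k x).
  rewrite /K (_ : - ((p + s * y) * x) = - (p * x) + - (x * s * y)); last by ring.
  by rewrite expRD; ring.
have q0 y : D y -> 0 < p + s * y.
  by rewrite RplusE => y0; rewrite addr_gt0// mulr_gt0.
have mK : measurable_fun (D `*` D) (fun z : R * R => K z.1 z.2).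
  apply: measurable_funM.
    apply: measurable_funM.
      apply: measurable_funTS; apply: measurable_expRN2.
      exact: measurable_funM.
    apply: (measurable_comp (F := D) (f := k)) => //.
      by move=> _ [[x y] [/= Dx _] <-].
    exact: measurable_funTS.
  apply: measurable_funTS; apply: measurable_funM.
    by apply: measurableT_comp => //; exact: continuous_measurable_fun.
  apply: measurable_expRN2; apply: measurable_funM => //.
  exact: measurable_funM.
have K1 x : D x -> mu.-integrable D (EFin \o K x).
  rewrite RplusE => x0; apply: integrable_EFinZl => //.
  by apply: laplace_integrable; exact: mulr_gt0.
have ik y : D y -> mu.-integrable D (EFin \o fun x => expR (- ((p + s * y) * x)) * k x).
  by move=> Dy; apply: (@damped_integrable _ _ _ A) => //; exact: q0.
have K2 y : D y -> mu.-integrable D (EFin \o K ^~ y).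
  move=> Dy; rewrite (_ : K ^~ y = fun x => m y * (expR (- ((p + s * y) * x)) * k x));
    last by apply/funext => x; rewrite KE.
  by apply: integrable_EFinZl => //; exact: ik.
have [iS IS] := @sin_density_integral R.
pose G y := A * (a^-1 + p^-1) * sin_density y.
have intG : mu.-integrable D (EFin \o G) by apply: integrable_EFinZl.
have A0 : 0 <= A by rewrite (le_trans _ (kA 1 _)).
have K_G y : D y -> \int[mu]_(x in D) `|K x y| <= G y.
  move=> Dy; have qy := q0 y Dy; have [ie Ie] := exp_integral qy.
  have y0 : 0 < y by rewrite -RplusE.
  apply: (@le_trans _ _ (\int[mu]_(x in D) (m y * A * expR (- ((p + s * y) * x))))).
    apply: le_Rintegral => //; first exact: (integrable_norm (K2 y Dy)).
      exact: integrable_EFinZl.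
    move=> x; rewrite RplusE => x0; rewrite KE !normrM (ger0_norm (m_ge0 y0)).
    rewrite -mulrA ler_wpM2l ?m_ge0// mulrC (ger0_norm (expR_ge0 _)).
    by rewrite ler_wpM2r ?expR_ge0 ?kA.
  rewrite RintegralZl// Ie /G mulrAC mulrC -mulrA ler_wpM2l//.
  exact: m_inv (I_ge Is) p0 y0.
have [h1 h2 h3] := Rintegral_Fubini_lebesgue (measurable_itv _) (measurable_itv _) mK K1 K2 intG K_G.
have E1 x : D x -> \int[mu]_(y in D) K x y = expR (- (p * x)) * (k x * laplace m (x * s)).
  rewrite RplusE => x0; rewrite mulrA /laplace.
  by rewrite -(RintegralZl _ _ (laplace_integrable (mulr_gt0 x0 s0))).
have E2 y : D y -> \int[mu]_(x in D) K x y =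
    m y * \int[mu]_(x in D) (expR (- ((p + s * y) * x)) * k x).
  move=> Dy; rewrite -[RHS](RintegralZl (m y) _ (ik y Dy)); last by [].
  by apply: eq_Rintegral => x _; rewrite KE.
split.
- apply: eq_integrable h1; first by [].
  by move=> x /set_mem Dx /=; rewrite E1.
- apply: eq_integrable h2; first by [].
  by move=> y /set_mem Dy /=; rewrite E2.
- transitivity (\int[mu]_(x in D) \int[mu]_(y in D) K x y).
    by apply: eq_Rintegral => x /set_mem Dx; rewrite E1.
  by rewrite h3; apply: eq_Rintegral => y /set_mem Dy; rewrite E2.
Qed.

(** Applied to |k|, the preceding exchange computes the integral of the absolute value
exactly; its bound is uniform in s. *)
Lemma damped_laplace_norm_le p s (k : R -> R) (A : R) : 0 < p -> I s ->
  measurable_fun D k -> (forall x, 0 < x -> `|k x| <= A) ->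
  \int[mu]_(x in D) `|expR (- (p * x)) * (k x * laplace m (x * s))| <=
  A * (a^-1 + p^-1) * (pi / 2).
Proof.
move=> p0 Is mk kA; have s0 := I_gt0 Is.
have mk' : measurable_fun D (fun x => `|k x|) by exact: measurableT_comp.
have kA' x : 0 < x -> `| `|k x| | <= A by rewrite normr_id; exact: kA.
have [_ h2 h3] := damped_laplace_Fubini p0 Is mk' kA'.
have A0 : 0 <= A by rewrite (le_trans _ (kA 1 _)).
have [iS IS] := @sin_density_integral R.
rewrite (_ : \int[mu]_(x in D) _ =
  \int[mu]_(x in D) (expR (- (p * x)) * (`|k x| * laplace m (x * s)))); last first.
  apply: eq_Rintegral => x _; rewrite !normrM (ger0_norm (expR_ge0 _)).
  by rewrite (ger0_norm (laplace_ge0 _)).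
rewrite h3 -IS -[leRHS](RintegralZl _ _ iS)//; apply: le_Rintegral => //.
  exact: integrable_EFinZl.
move=> y Dy; have y0 : 0 < y by rewrite -RplusE.
have qy : 0 < p + s * y by rewrite addr_gt0// mulr_gt0.
have [ie Ie] := exp_integral qy.
have ik : mu.-integrable D (EFin \o fun x => expR (- ((p + s * y) * x)) * `|k x|).
  exact: (@damped_integrable _ _ _ A).
apply: (@le_trans _ _ (m y * (A / (p + s * y)))).
  apply: ler_wpM2l; first exact: m_ge0.
  rewrite -Ie -[leRHS](RintegralZl _ _ ie)//; apply: le_Rintegral => //.
    exact: integrable_EFinZl.
  by move=> x; rewrite RplusE => x0; rewrite mulrC ler_wpM2r ?expR_ge0 ?kA.
rewrite mulrCA -mulrA ler_wpM2l//.
exact: m_inv (I_ge Is) p0 y0.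
Qed.

Lemma laplace_mul_integrable f x : mu.-integrable I (EFin \o f) -> 0 < x ->
  mu.-integrable I (EFin \o fun s => f s * laplace m (x * s)).
Proof.
move=> intf x0; apply: (@integrable_mul_bounded _ _ _ _ _ _ _ (2 / (x * a))) => //.
  apply: (measurable_section (K := fun x s => laplace m (x * s)) _ _ measurable_laplace2) => //.
  by rewrite RplusE.
move=> s Is; have s0 := I_gt0 Is.
rewrite (le_trans (laplace_le (mulr_gt0 x0 s0)))// ler_wpM2l// lef_pV2 ?posrE ?mulr_gt0//.
by rewrite ler_wpM2l ?(ltW x0) ?I_ge.
Qed.

(** The kernel of the cross term: the integral of exp(-p x) u y equals the double
integral of f(s) f(t) times this kernel.  At p = 0 and off the
diagonal it is (pi/2) / (s + t). *)
Definition cross_kernel p s t := \int[mu]_(y in D) (m y * r (p + s * y) t).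

Let measurable_r (c p : R) : measurable_fun setT (fun z : R * R => r (p + c * z.2) z.1).
Proof.
apply: (measurableT_comp (f := fun z : R * R => r z.1 z.2)
  (g := fun z : R * R => (p + c * z.2, z.1))) => //.
apply/measurable_fun_pairP; split => /=; last exact: measurable_fst.
by apply: measurable_funD => //; exact: measurable_funM.
Qed.

Lemma measurable_mr p s : measurable_fun (I `*` D)
  (fun z : R * R => m z.2 * r (p + s * z.2) z.1).
Proof.
apply: measurable_funTS; apply: measurable_funM; last exact: measurable_r.
by apply: measurableT_comp => //; exact: continuous_measurable_fun.
Qed.

Lemma mr_integrable p s t : 0 <= p -> I s -> I t ->
  mu.-integrable D (EFin \o fun y => m y * r (p + s * y) t).
Proof.
move=> p0 Is It; have [iS _] := @sin_density_integral R.
have iaS : mu.-integrable D (EFin \o fun y => a^-1 * sin_density y).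
  exact: integrable_EFinZl.
apply: integrable_dominated iaS _ => //.
  exact: (measurable_section (K := fun t y => m y * r (p + s * y) t) _ _ (@measurable_mr p s) It).
move=> y; rewrite RplusE => y0.
exact: m_r a0 (I_ge Is) (I_ge It) p0 y0.
Qed.

Lemma cross_kernel_le p s t : 0 <= p -> I s -> I t ->
  `|cross_kernel p s t| <= a^-1 * (pi / 2).
Proof.
move=> p0 Is It; have [iS IS] := @sin_density_integral R.
have im := mr_integrable p0 Is It.
apply: le_trans (le_normr_Rintegral _ im) _ => //.
rewrite -IS -[leRHS](RintegralZl _ _ iS)//; apply: le_Rintegral => //.
- exact: (integrable_norm im).
- exact: integrable_EFinZl.
- move=> y; rewrite RplusE => y0; exact: m_r a0 (I_ge Is) (I_ge It) p0 y0.
Qed.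

Lemma measurable_cross_kernel p s : measurable_fun I (cross_kernel p s).
Proof.
by apply: (measurable_Rintegral_lebesgue (K := fun t y => m y * r (p + s * y) t) _ _ (@measurable_mr p s)).
Qed.

(** Dominated convergence with dominating function a^-1 / (1 + y^2). *)
Lemma cvg_cross_kernel s t : I s -> I t ->
  cross_kernel (eps R n) s t @[n --> \oo] --> cross_kernel 0 s t.
Proof.
move=> Is It; have [iS _] := @sin_density_integral R.
have [||||_ L] := @Rintegral_dominated_cvg _ _ _ mu D
  (fun n y => m y * r (eps R n + s * y) t) (fun y => m y * r (0 + s * y) t)
  (fun y => a^-1 * sin_density y) (measurable_itv _) _ _ _ _; last exact: L.
- move=> n; exact: (measurable_section (K := fun t y => m y * r (eps R n + s * y) t)
    _ _ (@measurable_mr (eps R n) s) It).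
- move=> y; rewrite RplusE => y0; apply: cvgMl_tmp.
  have sy0 : 0 < 0 + s * y by rewrite add0r mulr_gt0// I_gt0.
  apply: (@cvg_comp _ _ _ (fun n => eps R n + s * y) (r ^~ t)); last exact: (cr sy0).
  by apply: cvgD; [exact: cvg_eps|exact: cvg_cst].
- exact: integrable_EFinZl.
- move=> n y; rewrite RplusE => y0.
  exact: m_r a0 (I_ge Is) (I_ge It) (ltW (eps_gt0 R n)) y0.
Qed.

Section fixed_function.
Variable f : R -> R.
Hypothesis intf : mu.-integrable I (EFin \o f).

Let mf : measurable_fun I f.
Proof. by case/integrableP : intf => /measurable_EFinP. Qed.

Notation trig := (trig_transform f).

Let mtrig : measurable_fun D trig.
Proof. exact: measurable_trig_transform. Qed.

Let trig_le x : 0 < x -> `|trig x| <= \int[mu]_(t in I) `|f t|.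
Proof. exact: trig_transform_le. Qed.

Lemma cross_kernel_mul_integrable p s : 0 <= p -> I s ->
  mu.-integrable I (EFin \o fun t => f t * cross_kernel p s t).
Proof.
move=> p0 Is; apply: (@integrable_mul_bounded _ _ _ _ _ _ _ (a^-1 * (pi / 2))) => //.
  exact: measurable_cross_kernel.
by move=> t It; exact: cross_kernel_le.
Qed.

Lemma damped_trig p : 0 < p ->
  \int[mu]_(x in D) (expR (- (p * x)) * trig x) = \int[mu]_(t in I) (f t * r p t).
Proof.
move=> p0; have [ie _] := exp_integral p0.
have me : measurable_fun (D `*` I) (fun z : R * R => e (z.1 * z.2)).
  exact: measurable_mul2.
rewrite (Rintegral_Fubini_bounded_lebesgue (K := fun x t => e (x * t)) (M := 1) _ _ me ie intf)//.
by apply: eq_Rintegral => t _; rewrite er.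
Qed.

Lemma r_mul_integrable q : 0 < q -> mu.-integrable I (EFin \o fun t => f t * r q t).
Proof.
move=> q0; apply: (@integrable_mul_bounded _ _ _ _ _ _ _ q^-1) => //.
  apply: (measurable_comp (F := setT) (f := fun z : R * R => r z.1 z.2)
    (g := fun t => (q, t))) => //.
  exact: measurable_funTS (measurable_pair1 q).
by move=> t _; exact: r_le.
Qed.

(** The weight 1/(1 + y^2) is split off from m r as the integrable factor; the
remaining kernel [K] is bounded by 1/a. *)
Lemma cross_kernel_Fubini p s : 0 <= p -> I s ->
  \int[mu]_(y in D) (m y * \int[mu]_(t in I) (f t * r (p + s * y) t)) =
  \int[mu]_(t in I) (f t * cross_kernel p s t).
Proof.
move=> p0 Is; have [iS _] := @sin_density_integral R.
pose K y t := (1 + y ^+ 2) * (m y * r (p + s * y) t).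
have K_a y t : D y -> I t -> `|K y t| <= a^-1.
  rewrite RplusE => y0 It; rewrite /K normrM (gtr0_norm (oneDsq_gt0 _)).
  rewrite mulrC -ler_pdivlMr ?oneDsq_gt0//.
  exact: m_r a0 (I_ge Is) (I_ge It) p0 y0.
have KE y t : sin_density y * K y t = m y * r (p + s * y) t.
  by rewrite /K /sin_density mulrA mulVf ?mul1r// gt_eqF// oneDsq_gt0.
have mK : measurable_fun (D `*` I) (fun z : R * R => K z.1 z.2).
  apply: measurable_funTS; apply: measurable_funM.
    by apply: measurable_funD => //; exact: measurable_funX.
  apply: measurable_funM; first by apply: measurableT_comp => //; exact: continuous_measurable_fun.
  apply: (measurableT_comp (f := fun z : R * R => r z.1 z.2)
    (g := fun z : R * R => (p + s * z.1, z.2))) => //.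
  apply/measurable_fun_pairP; split => /=; last exact: measurable_snd.
  by apply: measurable_funD => //; exact: measurable_funM.
have F := Rintegral_Fubini_bounded_lebesgue (measurable_itv _) (measurable_itv _) mK iS intf K_a.
transitivity (\int[mu]_(x in D) (sin_density x * \int[mu]_(y in I) (f y * K x y))).
  apply: eq_Rintegral => y /set_mem Dy.
  have iK : mu.-integrable I (EFin \o fun t => f t * K y t).
    apply: (@integrable_mul_bounded _ _ _ _ _ _ _ a^-1);
      [by []| |exact: intf|by move=> t; exact: K_a].
    exact: measurable_section mK Dy.
  have ir : mu.-integrable I (EFin \o fun t => f t * r (p + s * y) t).
    move: Dy; rewrite RplusE => y0; apply: r_mul_integrable.
    by apply: ltr_wpDl p0 _; exact: mulr_gt0 (I_gt0 Is) y0.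
  rewrite -[LHS](RintegralZl _ _ ir); last by [].
  rewrite -[RHS](RintegralZl _ _ iK); last by [].
  by apply: eq_Rintegral => t _; rewrite mulrCA -KE mulrCA.
rewrite F; apply: eq_Rintegral => t _; congr (_ * _).
by apply: eq_Rintegral => y _; rewrite KE.
Qed.

(** Four exchanges: the outer one between x and s, the one between x and the Laplace
variable y for each s, then x and t for each y, and finally y and t. *)
Lemma damped_cross_product p : 0 < p ->
  [/\ mu.-integrable D (EFin \o fun x => expR (- (p * x)) * (trig x * laplace_transform f x)),
      measurable_fun I (fun s => f s * \int[mu]_(t in I) (f t * cross_kernel p s t)) &
      \int[mu]_(x in D) (expR (- (p * x)) * (trig x * laplace_transform f x)) =
      \int[mu]_(s in I) (f s * \int[mu]_(t in I) (f t * cross_kernel p s t))].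
Proof.
move=> p0.
pose w x := expR (- (p * x)).
pose K x s := w x * trig x * (f s * laplace m (x * s)).
have KE x s : K x s = f s * (w x * (trig x * laplace m (x * s))) by rewrite /K; ring.
have mK : measurable_fun (D `*` I) (fun z : R * R => K z.1 z.2).
  apply: measurable_funM.
    apply: (measurable_comp (F := D) (f := fun x => w x * trig x)) => //.
    - by move=> _ [[x y] [/= Dx _] <-].
    - apply: measurable_funM => //; apply: measurable_funTS.
      apply: continuous_measurable_fun; exact: continuous_expRN.
    - exact: measurable_funTS.
  apply: measurable_funM; last exact: measurable_laplace2.
  apply: (measurable_comp (F := I) (f := f)) => //.
    by move=> _ [[x y] [/= _ Iy] <-].
  exact: measurable_funTS.
have ifl x : D x -> mu.-integrable I (EFin \o fun s => f s * laplace m (x * s)).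
  by rewrite RplusE; exact: laplace_mul_integrable.
have K1 x : D x -> mu.-integrable I (EFin \o K x).
  by move=> Dx; apply: integrable_EFinZl; [exact: measurable_itv|exact: ifl].
have F1 s (Is : I s) := damped_laplace_Fubini p0 Is mtrig trig_le.
have K2 s : I s -> mu.-integrable D (EFin \o K ^~ s).
  move=> Is; rewrite (_ : K ^~ s = fun x => f s * (w x * (trig x * laplace m (x * s))));
    last by apply/funext => x; rewrite KE.
  by apply: integrable_EFinZl; [exact: measurable_itv|have [] := F1 s Is].
pose C := (\int[mu]_(t in I) `|f t|) * (a^-1 + p^-1) * (pi / 2).
have intG : mu.-integrable I (EFin \o fun s => C * `|f s|).
  by apply: integrable_EFinZl => //; exact: (integrable_norm intf).
have K_G s : I s -> \int[mu]_(x in D) `|K x s| <= C * `|f s|.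
  move=> Is; have [i1 _ _] := F1 s Is.
  have i2 := integrable_norm i1.
  rewrite (_ : \int[mu]_(x in D) `|K x s| =
      \int[mu]_(x in D) (`|f s| * `|w x * (trig x * laplace m (x * s))|)); last first.
    by apply: eq_Rintegral => x _; rewrite KE normrM.
  rewrite (RintegralZl _ _ i2); last by [].
  rewrite mulrC ler_wpM2r//.
  exact: damped_laplace_norm_le p0 Is mtrig trig_le.
have [h1 h2 h3] := Rintegral_Fubini_lebesgue (measurable_itv _) (measurable_itv _) mK K1 K2 intG K_G.
have E1 x : D x -> \int[mu]_(s in I) K x s = w x * (trig x * laplace_transform f x).
  by move=> Dx; rewrite mulrA /laplace_transform -[RHS](RintegralZl _ _ (ifl x Dx)); last by [].
have E2 s : I s -> \int[mu]_(x in D) K x s = f s * \int[mu]_(t in I) (f t * cross_kernel p s t).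
  move=> Is; have [i1 _ e1] := F1 s Is.
  transitivity (f s * \int[mu]_(x in D) (w x * (trig x * laplace m (x * s)))).
    rewrite -[RHS](RintegralZl _ _ i1); last by [].
    by apply: eq_Rintegral => x _; rewrite KE.
  congr (_ * _); rewrite e1 -(cross_kernel_Fubini (ltW p0) Is).
  apply: eq_Rintegral => y /set_mem; rewrite RplusE => y0; congr (_ * _).
  exact: damped_trig (addr_gt0 p0 (mulr_gt0 (I_gt0 Is) y0)).
split.
- apply: eq_integrable h1; first by [].
  by move=> x /set_mem Dx /=; rewrite E1.
- have /measurable_int/measurable_EFinP := h2; apply: eq_measurable_fun.
  by move=> s /set_mem Is; rewrite E2.
- transitivity (\int[mu]_(x in D) \int[mu]_(s in I) K x s).
    by apply: eq_Rintegral => x /set_mem Dx; rewrite E1.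
  by rewrite h3; apply: eq_Rintegral => s /set_mem Is; rewrite E2.
Qed.

(** The kernel 1/(s + t) is the integral of exp(-(s + t) x) over x > 0, so its quadratic
form is the integral of a square.  This positivity is the heart of the proof. *)
Lemma hilbert_kernel_Fubini :
  \int[mu]_(s in I) (f s * \int[mu]_(t in I) (f t * (s + t)^-1)) =
  \int[mu]_(x in D) (\int[mu]_(t in I) (f t * expR (- (x * t)))) ^+ 2.
Proof.
pose L x := \int[mu]_(t in I) (f t * expR (- (x * t))).
(* The weight exp(-a x) serves as the integrable factor, which leaves the bounded
   factors exp(-(s - a + t) x) and exp(-(s - a) x), as s > a on the interval. *)
have [ie _] := exp_integral a0.
have mexp (c d : R) : measurable_fun (D `*` I) (fun z : R * R => expR (- (z.1 * (c + d * z.2)))).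
  apply: measurable_funTS; apply: measurable_expRN2; apply: measurable_funM => //.
  by apply: measurable_funD => //; exact: measurable_funM.
have exp_le1 x y : 0 < x -> 0 <= y -> `|expR (- (x * y))| <= 1.
  by move=> x0 y0; rewrite ger0_norm ?expR_ge0// -expR0 ler_expR oppr_le0 mulr_ge0// ltW.
have mL : measurable_fun D L.
  apply: (measurable_bounded_Rintegral_lebesgue (K := fun x t => expR (- (x * t))) _ _ _ intf) => //.
  by apply: measurable_funTS; apply: measurable_expRN2; exact: measurable_funM.
have L_le x : 0 < x -> `|L x| <= \int[mu]_(t in I) `|f t|.
  rewrite -RplusE -[leRHS]mul1r => Dx.
  apply: (bounded_Rintegral_le_lebesgue (K := fun x t => expR (- (x * t))) _ _ _ intf _ Dx) => //.
    by apply: measurable_funTS; apply: measurable_expRN2; exact: measurable_funM.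
  by move=> x' t; rewrite RplusE => x0 It; apply: exp_le1 => //; exact/ltW/I_gt0.
have iL : mu.-integrable D (EFin \o fun x => expR (- (a * x)) * L x).
  exact: damped_integrable a0 mL L_le.
have step1 s : I s -> \int[mu]_(t in I) (f t * (s + t)^-1) =
    \int[mu]_(x in D) (expR (- (a * x)) * L x * expR (- (x * (- a + 1 * s)))).
  move=> Is; have sa : 0 <= s - a by rewrite subr_ge0 I_ge.
  transitivity (\int[mu]_(x in D) (expR (- (a * x)) *
     \int[mu]_(t in I) (f t * expR (- (x * (s - a + 1 * t)))))).
    rewrite (Rintegral_Fubini_bounded_lebesgue (K := fun x t => expR (- (x * (s - a + 1 * t))))
      (M := 1) _ _ (@mexp _ _) ie intf)//; last first.
      move=> x t; rewrite RplusE => x0 It; apply: exp_le1 => //.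
      by rewrite mul1r addr_ge0// ltW ?I_gt0.
    apply: eq_Rintegral => t /set_mem It; congr (_ * _).
    have st0 : 0 < s + t by rewrite addr_gt0// I_gt0.
    have [_ <-] := exp_integral st0; apply: eq_Rintegral => x _.
    by rewrite -expRD; congr expR; ring.
  apply: eq_Rintegral => x /set_mem; rewrite RplusE => x0.
  have ix : mu.-integrable I (EFin \o fun t => f t * expR (- (x * t))).
    apply: (@integrable_mul_bounded _ _ _ _ _ _ _ 1) => //; last first.
      by move=> t It; apply: exp_le1 => //; exact/ltW/I_gt0.
    have E t : - (x * t) = - (x * (0 + 1 * t)) by ring.
    by rewrite (funext (fun t => congr1 expR (E t))); exact: measurable_expR_affine.
  rewrite -mulrA; congr (_ * _); rewrite -[RHS](RintegralZr _ _ ix); last by [].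
  apply: eq_Rintegral => t _; rewrite -mulrA; congr (_ * _).
  by rewrite -expRD; congr expR; ring.
transitivity (\int[mu]_(s in I) (f s *
   \int[mu]_(x in D) (expR (- (a * x)) * L x * expR (- (x * (- a + 1 * s)))))).
  by apply: eq_Rintegral => s /set_mem Is; rewrite step1.
have bd x t : D x -> I t -> `|expR (- (x * (- a + 1 * t)))| <= 1.
  rewrite RplusE => x0 It; apply: exp_le1 => //.
  by rewrite mul1r addrC subr_ge0 I_ge.
have F := Rintegral_Fubini_bounded_lebesgue (K := fun x s => expR (- (x * (- a + 1 * s))))
  (measurable_itv _) (measurable_itv _) (@mexp _ _) iL intf bd.
apply: etrans (esym F) _; apply: eq_Rintegral => x /set_mem Dx.
have x0 : 0 < x by rewrite -RplusE.
rewrite expr2 -/(L x) mulrAC; congr (_ * _).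
have ix : mu.-integrable I (EFin \o fun y => f y * expR (- (x * (- a + 1 * y)))).
  apply: (@integrable_mul_bounded _ _ _ _ _ _ _ 1); [by []| |exact: intf|by move=> t; exact: bd].
  exact: measurable_expR_affine.
rewrite -[LHS](RintegralZl _ _ ix); last by [].
apply: eq_Rintegral => t _; rewrite mulrCA; congr (_ * _).
by rewrite -expRD; congr expR; ring.
Qed.

Lemma cross_kernel0 s t : I s -> I t -> s != t -> cross_kernel 0 s t = pi / 2 * (s + t)^-1.
Proof.
move=> Is It st; rewrite -(m_r0 (I_gt0 Is) (I_gt0 It) st).
by apply: eq_Rintegral => y _; rewrite add0r.
Qed.

(** The kernels agree off the diagonal, and for fixed s the diagonal is one point. *)
Lemma cross_kernel0_integral s : I s ->
  \int[mu]_(t in I) (f t * cross_kernel 0 s t) =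
  pi / 2 * \int[mu]_(t in I) (f t * (s + t)^-1).
Proof.
move=> Is.
have ist : mu.-integrable I (EFin \o fun t => f t * (s + t)^-1).
  apply: (@integrable_mul_bounded _ _ _ _ _ _ _ a^-1) => //.
    apply: open_continuous_measurable_fun; first exact: interval_open.
    move=> t; rewrite inE => It; apply: cvgV; first by rewrite gt_eqF// addr_gt0// I_gt0.
    by apply: cvgD; [exact: cvg_cst|exact: cvg_id].
  move=> t It; have s0 := I_gt0 Is; have t0 := I_gt0 It.
  rewrite gtr0_norm ?invr_gt0 ?addr_gt0// lef_pV2 ?posrE ?addr_gt0//.
  by rewrite (le_trans (I_ge Is))// lerDl ltW.
have ick := cross_kernel_mul_integrable (lexx 0) Is.
rewrite -[RHS](RintegralZl _ _ ist); last by [].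
rewrite /Rintegral; congr fine; apply: ae_eq_integral => //.
- by case/integrableP : ick.
- have isc : mu.-integrable I (EFin \o fun t => pi / 2 * (f t * (s + t)^-1)).
    exact: integrable_EFinZl.
  by case/integrableP : isc.
exists [set s]; split => //; first exact: lebesgue_measure_set1.
move=> t /= /not_implyP[It]; apply: contra_notP => /eqP ts.
by rewrite cross_kernel0 1?eq_sym// mulrCA.
Qed.

(** The cross kernels are bounded by (1/a) (pi/2) for all p >= 0, so the limit may be
taken inside both integrals, where [hilbert_kernel_Fubini] gives its sign. *)
Lemma cvg_damped_cross_product :
  exists2 l : R, 0 <= l &
  \int[mu]_(x in D) (expR (- (eps R n * x)) * (trig x * laplace_transform f x))
    @[n --> \oo] --> l.
Proof.
have C n := damped_cross_product (eps_gt0 R n).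
have a1 : 0 <= a^-1 * (pi / 2) by rewrite mulr_ge0 ?invr_ge0 ?(ltW a0)// divr_ge0 ?pi_ge0.
pose A := \int[mu]_(t in I) `|f t|.
have inner_le p s : 0 <= p -> I s ->
    `|\int[mu]_(t in I) (f t * cross_kernel p s t)| <= a^-1 * (pi / 2) * A.
  move=> p0 Is; have ick := cross_kernel_mul_integrable p0 Is.
  apply: le_trans (le_normr_Rintegral _ ick) _ => //.
  have iaf := integrable_norm intf.
  rewrite -[leRHS](RintegralZl _ _ iaf); last by [].
  apply: le_Rintegral => //; [exact: (integrable_norm ick)|exact: integrable_EFinZl|].
  move=> t It; rewrite normrM mulrC; apply: ler_wpM2r => //.
  exact: cross_kernel_le.
have [||||i0 L] := @Rintegral_dominated_cvg _ _ _ mu I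
  (fun n s => f s * \int[mu]_(t in I) (f t * cross_kernel (eps R n) s t))
  (fun s => f s * \int[mu]_(t in I) (f t * cross_kernel 0 s t))
  (fun s => a^-1 * (pi / 2) * A * `|f s|) (measurable_itv _).
- by move=> n; have [] := C n.
- move=> s Is; apply: cvgMl_tmp.
  have [||||_ L] := @Rintegral_dominated_cvg _ _ _ mu I
    (fun n t => f t * cross_kernel (eps R n) s t)
    (fun t => f t * cross_kernel 0 s t)
    (fun t => a^-1 * (pi / 2) * `|f t|) (measurable_itv _) _ _ _ _; last exact: L.
  + by move=> n; apply: measurable_funM => //; exact: measurable_cross_kernel.
  + by move=> t It; apply: cvgMl_tmp; exact: cvg_cross_kernel.
  + by apply: integrable_EFinZl => //; exact: (integrable_norm intf).
  + move=> n t It; rewrite normrM mulrC; apply: ler_wpM2r => //.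
    exact: cross_kernel_le (ltW (eps_gt0 R n)) Is It.
- by apply: integrable_EFinZl => //; exact: (integrable_norm intf).
- move=> n s Is; rewrite normrM mulrC; apply: ler_wpM2r => //.
  exact: inner_le (ltW (eps_gt0 R n)) Is.
exists (\int[mu]_(s in I) (f s * \int[mu]_(t in I) (f t * cross_kernel 0 s t))); last first.
  rewrite (_ : (fun n => _) = (fun n => \int[mu]_(s in I)
    (f s * \int[mu]_(t in I) (f t * cross_kernel (eps R n) s t)))); first exact: L.
  by apply/funext => n; have [_ _] := C n.
have ih : mu.-integrable I (EFin \o fun s => f s * \int[mu]_(t in I) (f t * (s + t)^-1)).
  have i1 : mu.-integrable I (EFin \o fun s =>
      (pi / 2)^-1 * (f s * \int[mu]_(t in I) (f t * cross_kernel 0 s t))).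
    exact: integrable_EFinZl.
  apply: eq_integrable i1; first by [].
  move=> s /set_mem Is /=; rewrite cross_kernel0_integral//; congr EFin.
  have : pi / 2 != 0 :> R by rewrite gt_eqF// divr_gt0// pi_gt0.
  by generalize (pi / 2 : R) => c c0; field.
rewrite (_ : \int[mu]_(s in I) _ = \int[mu]_(s in I)
   (pi / 2 * (f s * \int[mu]_(t in I) (f t * (s + t)^-1)))); last first.
  by apply: eq_Rintegral => s /set_mem Is; rewrite cross_kernel0_integral// mulrCA.
rewrite (RintegralZl _ _ ih); last by [].
rewrite hilbert_kernel_Fubini mulr_ge0 ?divr_ge0 ?pi_ge0//.
by apply: Rintegral_ge0 => x _; exact: sqr_ge0.
Qed.

Notation A x := (trig_transform f x + pi^-1 * laplace_transform f x).

Lemma measurable_laplace_transform : measurable_fun D (laplace_transform f).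
Proof.
apply: (measurable_bounded_Rintegral_lebesgue (K := fun x s => laplace m (x * s)) _ _ _ intf) => //.
exact: measurable_laplace2.
Qed.

Lemma measurable_kernel_transform : measurable_fun D (fun x => A x).
Proof.
apply: measurable_funD; first exact: measurable_trig_transform.
by apply: measurable_funM => //; exact: measurable_laplace_transform.
Qed.

(** The inequality
    (u + y/pi)^2 >= exp(-p x) (2 u v - v^2 + (2/pi) u y)
holds because 2 u v - v^2 = u^2 - (u - v)^2 and 0 < exp(-p x) <= 1.  Integrate it and
let p tend to 0; the cross term has a nonnegative limit and can be dropped. *)
Lemma kernel_transform_ge h (H : R) : continuous h -> (forall x, `|h x| <= H) ->
  ((pi / 2 * (2 * (\int[mu]_(t in I) (f t * h t)) - \int[mu]_(t in I) (h t * h t)))%:E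
  <= \int[mu]_(x in D) ((A x) ^+ 2)%:E)%E.
Proof.
move=> ch h_H; have mA := measurable_kernel_transform.
set RHS := (X in (_ <= X)%E).
have [->|Rfin] := eqVneq RHS +oo%E; first by rewrite leey.
have iA : mu.-integrable D (EFin \o fun x => (A x) ^+ 2).
  apply/integrableP; split; first by apply/measurable_EFinP; exact: measurable_funX.
  rewrite (_ : (\int[mu]_(x in D) _)%E = RHS); first by rewrite ltey.
  by apply: eq_integral => x _ /=; rewrite ger0_norm ?sqr_ge0.
rewrite /RHS -EFin_Rintegral// lee_fin.
have inth := continuous_integrable_oo a b ch.
have [l l0 Cl] := cvg_damped_cross_product.
have Cfh := cvg_damped_trig_product ch h_H intf.
have Chh := cvg_damped_trig_product ch h_H inth.
(* The integral of the right side of this inequality, at p = eps n. *)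
pose W n := 2 * \int[mu]_(x in D) (expR (- (eps R n * x)) *
    (trig_transform f x * trig_transform h x))
  - \int[mu]_(x in D) (expR (- (eps R n * x)) *
    (trig_transform h x * trig_transform h x))
  + 2 * pi^-1 * \int[mu]_(x in D) (expR (- (eps R n * x)) *
    (trig_transform f x * laplace_transform f x)).
have W_le n : W n <= \int[mu]_(x in D) ((A x) ^+ 2).
  have en := eps_gt0 R n.
  have i1 := damped_trig_integrable en intf inth.
  have i2 := damped_trig_integrable en inth inth.
  have [i3 _ _] := damped_cross_product en.
  have j1 : mu.-integrable D (EFin \o fun x => 2 * (expR (- (eps R n * x)) *
    (trig_transform f x * trig_transform h x))) by exact: integrable_EFinZl.
  have j3 : mu.-integrable D (EFin \o fun x => 2 * pi^-1 * (expR (- (eps R n * x)) *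
    (trig_transform f x * laplace_transform f x))) by exact: integrable_EFinZl.
  have j12 : mu.-integrable D (EFin \o fun x => 2 * (expR (- (eps R n * x)) *
    (trig_transform f x * trig_transform h x)) - (expR (- (eps R n * x)) *
    (trig_transform h x * trig_transform h x))) by exact: integrable_EFinB.
  rewrite /W -(RintegralZl _ _ i1)// -(RintegralZl _ _ i3)// -(RintegralB _ j1 i2)//.
  rewrite -(RintegralD _ j12 j3)//; apply: le_Rintegral => //.
    exact: integrable_EFinD.
  move=> x; rewrite RplusE => x0.
  set w := expR _; set u := trig_transform f x; set v := trig_transform h x.
  set y := laplace_transform f x.
  have w0 : 0 <= w by exact: expR_ge0.
  have w1 : w <= 1 by rewrite -expR0 ler_expR oppr_le0 mulr_ge0// ltW.
  apply: (@le_trans _ _ (w * (u + pi^-1 * y) ^+ 2)); last first.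
    by rewrite ler_piMl ?sqr_ge0.
  rewrite -subr_ge0 (_ : _ - _ = w * ((u - v) ^+ 2 + (pi^-1 * y) ^+ 2)); last by ring.
  by rewrite mulr_ge0// addr_ge0// sqr_ge0.
have CW : W n @[n --> \oo] --> 2 * (pi / 2 * \int[mu]_(t in I) (f t * h t))
   - pi / 2 * \int[mu]_(t in I) (h t * h t) + 2 * pi^-1 * l.
  apply: cvgD; last by apply: cvgMl_tmp; exact: Cl.
  by apply: cvgB; [apply: cvgMl_tmp; exact: Cfh|exact: Chh].
have : 2 * (pi / 2 * \int[mu]_(t in I) (f t * h t))
   - pi / 2 * \int[mu]_(t in I) (h t * h t) + 2 * pi^-1 * l <= \int[mu]_(x in D) ((A x) ^+ 2).
  by apply: (cvgr_to_le CW); apply: nearW => n; exact: W_le.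
apply: le_trans; rewrite -subr_ge0 (_ : _ - _ = 2 * pi^-1 * l); last by ring.
by rewrite !mulr_ge0 ?invr_ge0 ?pi_ge0.
Qed.

End fixed_function.
End interval.

Variable k : R -> R -> R.
Hypothesis kE : forall x t, 0 < x -> 0 < t -> k x t = e (x * t) + pi^-1 * laplace m (x * t).

Lemma measurable_kernel x : 0 < x -> measurable_fun D (k x).
Proof.
move=> x0; apply: (eq_measurable_fun (fun t => e (x * t) + pi^-1 * laplace m (x * t))).
  by move=> t /set_mem; rewrite RplusE => t0; rewrite kE.
apply: measurable_funD.
  apply: measurable_funTS; apply: measurableT_comp; first exact: continuous_measurable_fun.
  exact: measurable_funM.
apply: measurable_funM => //.
apply: (measurable_comp (F := D) (f := laplace m)) => //.
- by move=> _ [t + <-]; rewrite !RplusE => t0; exact: mulr_gt0.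
- exact: measurable_laplace.
Qed.

Lemma kernel_integral a b f x : 0 < a -> 0 < x -> measurable_fun D f ->
  mu.-integrable `]a, b[ (EFin \o f) ->
  \int[mu]_(t in `[a, b]) (k x t * f t) =
  trig_transform a b f x + pi^-1 * laplace_transform a b f x.
Proof.
move=> a0 x0 mf intf; have mk := measurable_kernel x0.
have I0 t : `]a, b[%classic t -> 0 < t.
  by rewrite /= in_itv/= => /andP[at_ _]; exact: lt_trans at_.
rewrite Rintegral_itv_cc_oo; last first.
  by apply: measurable_funS (measurable_funM mk mf) => //; exact: subset_Rplus.
have i1 : mu.-integrable `]a, b[ (EFin \o fun t => f t * e (x * t)).
  apply: (@integrable_mul_bounded _ _ _ _ _ _ _ 1) => //.
  apply: measurable_funTS; apply: measurableT_comp; first exact: continuous_measurable_fun.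
  exact: measurable_funM.
have i2 := laplace_mul_integrable a0 intf x0.
have i3 : mu.-integrable `]a, b[ (EFin \o fun t => pi^-1 * (f t * laplace m (x * t))).
  exact: integrable_EFinZl.
rewrite /trig_transform /laplace_transform -(RintegralZl _ _ i2)// -(RintegralD _ i1 i3)//.
apply: eq_Rintegral => t /set_mem /I0 t0; rewrite kE//; ring.
Qed.

(** The lower bound (pi/2) (2 int f h - int h^2) equals
(pi/2) (int f^2 - int (f - h)^2), and h is arbitrarily close to f in L2. *)
Lemma kernel_expanding : expanding k.
Proof.
move=> a b f a0 ab mf if2.
have sD : `]a, b[ `<=` D by apply: subset_trans (@subset_Rplus _ a b a0); exact: subset_itv_oo_cc.
have mfI : measurable_fun `]a, b[ f by apply: measurable_funS mf.
have if2I : mu.-integrable `]a, b[ (EFin \o fun x => f x ^+ 2).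
  by apply: integrableS if2 => //.
have intf := square_integrable_integrable mfI if2I.
have E x : D x -> \int[mu]_(t in `[a, b]) (k x t * f t) =
    trig_transform a b f x + pi^-1 * laplace_transform a b f x.
  by rewrite RplusE => x0; exact: kernel_integral.
split.
  apply: (eq_measurable_fun (fun x => trig_transform a b f x + pi^-1 * laplace_transform a b f x)).
    by move=> x /set_mem Dx; rewrite E.
  exact: measurable_kernel_transform.
rewrite (_ : (\int[mu]_(x in D) _)%E = (\int[mu]_(x in D)
   ((trig_transform a b f x + pi^-1 * laplace_transform a b f x) ^+ 2)%:E)%E); last first.
  by apply: eq_integral => x /set_mem Dx; rewrite E.
apply/lee_addgt0Pr => d d0.
have d1 : 0 < d / (pi / 2) by rewrite divr_gt0// divr_gt0// pi_gt0.
have [h [ch [H hH]] [ih dh]] := continuous_dense_L2 mfI if2I d1.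
have ge := kernel_transform_ge a0 ab intf ch hH.
apply: le_trans (leeD ge (lexx d%:E)).
rewrite -EFinD lee_fin.
have ifh : mu.-integrable `]a, b[ (EFin \o fun t => f t * h t).
  apply: (@integrable_mul_bounded _ _ _ _ _ _ _ H) => //.
  by apply: measurable_funTS; exact: continuous_measurable_fun.
have ihh : mu.-integrable `]a, b[ (EFin \o fun t => h t * h t).
  by apply: continuous_integrable_oo => x; apply: cvgM; exact: ch.
have i2fh : mu.-integrable `]a, b[ (EFin \o fun t => 2 * (f t * h t)) by exact: integrable_EFinZl.
have i3 : mu.-integrable `]a, b[ (EFin \o fun t => 2 * (f t * h t) - h t * h t).
  exact: integrable_EFinB.
have -> : 2 * \int[mu]_(t in `]a, b[) (f t * h t) - \int[mu]_(t in `]a, b[) (h t * h t) =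
   \int[mu]_(t in `]a, b[) f t ^+ 2 - \int[mu]_(t in `]a, b[) (f t - h t) ^+ 2.
  rewrite -(RintegralZl _ _ ifh)// -(RintegralB _ i2fh ihh)// -(RintegralB _ if2I ih)//.
  by apply: eq_Rintegral => t _; ring.
have p0 : 0 < pi / 2 :> R by rewrite divr_gt0// pi_gt0.
have : pi / 2 * \int[mu]_(t in `]a, b[) (f t - h t) ^+ 2 <= d.
  by rewrite mulrC -ler_pdivlMr.
rewrite mulrBr; lra.
Qed.

End kernel_transform.

(** * The cosine and the sine kernel *)

Section lommel_kernels.
Variable R : realType.
Notation mu := (@lebesgue_measure R).
Notation D := (@Rplus R).
Implicit Types (f : R -> R) (a p q s t x : R).

Hint Extern 0 (measurable (@Rplus _)) => solve [exact: measurable_itv] : core.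

(** The inverse is written as a real power, whose measurability needs no care at 0,
where the sum of squares vanishes. *)
Lemma measurable_inv_sum_sqr :
  measurable_fun setT (fun z : R * R => (z.1 ^+ 2 + z.2 ^+ 2)^-1).
Proof.
rewrite (_ : (fun z => _) = fun z : R * R => (z.1 ^+ 2 + z.2 ^+ 2) `^ (-1)); last first.
  by apply/funext => z; rewrite powR_inv1// addr_ge0// sqr_ge0.
apply: (measurableT_comp (f := fun x : R => x `^ (-1))); first exact: measurable_powR.
by apply: measurable_funD; apply: measurable_funX.
Qed.

Lemma continuous_lorentz p t : 0 < p -> {for p, continuous (fun q => (q ^+ 2 + t ^+ 2)^-1)}.
Proof.
move=> p0; apply: cvgV; first by rewrite gt_eqF// poisson_den_gt0.
apply: cvgD; last exact: cvg_cst.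
by apply: (@cvgM _ _ _ _ id id); exact: cvg_id.
Qed.

(** Covers both partial fraction decompositions in the two proofs that follow. *)
Lemma lorentz_comb_integral (c d s t : R) : 0 < s -> 0 < t ->
  \int[mu]_(x in D) (c * sin_density x + d * (t / (t ^+ 2 + (s * x) ^+ 2))) =
  c * (pi / 2) + d * (pi / 2 / s).
Proof.
move=> s0 t0; have [iS IS] := @sin_density_integral R.
have [iL IL] := lorentz_integral s0 t0.
have i1 : mu.-integrable D (EFin \o fun x => c * sin_density x) by exact: integrable_EFinZl.
have i2 : mu.-integrable D (EFin \o fun x => d * (t / (t ^+ 2 + (s * x) ^+ 2))).
  exact: integrable_EFinZl.
by rewrite (RintegralD _ i1 i2)// (RintegralZl _ _ iS)// (RintegralZl _ _ iL)// IS IL.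
Qed.

(** The last hypothesis of [kernel_expanding] is the partial fraction decomposition
  x/(1 + x^2) * s x/(s^2 x^2 + t^2)
    = (- s/(1 + x^2) + s t * t/(t^2 + s^2 x^2)) / (t^2 - s^2),
whose integral over x > 0 is (pi/2) (t - s) / (t^2 - s^2). *)
Lemma cos_kernel_expanding : expanding (@cos_lommel_kernel R).
Proof.
apply: (@kernel_expanding _ cos (@cos_density R) (fun p t => p / (p ^+ 2 + t ^+ 2)) 1).
- exact: continuous_cos.
- exact: cos_le1.
- by rewrite normr1.
- move=> p t s p0; have [i1 I1] := exp_cos_integral (t - s) p0.
  have [i2 I2] := exp_cos_integral (- t - s) p0.
  rewrite /poisson -I1 -I2 mul1r -(RintegralD _ i1 i2)//.
  have i12 : mu.-integrable D (EFin \o fun x => expR (- (p * x)) * cos (x * (t - s)) +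
    expR (- (p * x)) * cos (x * (- t - s))) by exact: integrable_EFinD.
  rewrite -(RintegralZr _ _ i12)//; apply: eq_Rintegral => x _.
  by rewrite !mulrBr mulrN -opprD !cosB cosN cosD; field.
- exact: continuous_cos_density.
- move=> x x0; rewrite /cos_density mulr_ge0 ?(ltW x0)// invr_ge0.
  exact/ltW/oneDsq_gt0.
- by move=> x _; exact: cos_density_le1.
- by move=> p t p0; have [_] := exp_cos_integral t p0.
- by apply: measurable_funM => //; exact: measurable_inv_sum_sqr.
- move=> p t p0; apply: cvgM; first exact: cvg_id.
  exact: continuous_lorentz.
- move=> a p s t x a0 as_ at_ p0 x0; rewrite /cos_density -/(sin_density x).
  have S0 : 0 <= sin_density x by rewrite invr_ge0; exact/ltW/oneDsq_gt0.
  set q := p + s * x.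
  have aq : a * x <= q by rewrite /q ler_wpDl// ler_wpM2r// ltW.
  have q0 : 0 < q by rewrite (lt_le_trans _ aq)// mulr_gt0.
  have Q0 : 0 < q ^+ 2 + t ^+ 2 by exact: poisson_den_gt0.
  rewrite ger0_norm; last first.
    by apply: mulr_ge0; [exact: mulr_ge0 (ltW x0) S0|exact: divr_ge0 (ltW q0) (ltW Q0)].
  rewrite mulrAC; apply: ler_wpM2r => //.
  rewrite mulrA ler_pdivrMr// [leRHS]mulrC ler_pdivlMr//.
  have : x * q * a <= q * q by rewrite mulrAC ler_wpM2r ?(ltW q0)// mulrC.
  by have := sqr_ge0 t; rewrite -[q * q]expr2; lra.
- move=> a p s x a0 as_ p0 x0; rewrite /cos_density -/(sin_density x).
  have S0 : 0 <= sin_density x by rewrite invr_ge0; exact/ltW/oneDsq_gt0.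
  have q0 : 0 < p + s * x by rewrite addr_gt0// mulr_gt0// (lt_le_trans a0).
  rewrite mulrAC; apply: ler_wpM2r => //.
  apply: (@le_trans _ _ a^-1); last by rewrite lerDl invr_ge0 ltW.
  rewrite ler_pdivrMr// mulrC ler_pdivlMr// mulrC.
  by rewrite ler_wpDl ?(ltW p0)// ler_wpM2r// ltW.
- move=> s t s0 t0 st; have ts : t ^+ 2 - s ^+ 2 != 0.
    by rewrite subr_sqr mulf_neq0 ?(gt_eqF (addr_gt0 t0 s0))// subr_eq0 eq_sym.
  have [sn0 stn0] : s != 0 /\ s + t != 0 by rewrite (gt_eqF s0) (gt_eqF (addr_gt0 s0 t0)).
  transitivity (- s / (t ^+ 2 - s ^+ 2) * (pi / 2) + s * t / (t ^+ 2 - s ^+ 2) * (pi / 2 / s));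
    last first.
    by generalize (pi : R) => q; field; rewrite sn0 stn0.
  rewrite -(lorentz_comb_integral _ _ s0 t0); apply: eq_Rintegral => x _.
  have S0 := oneDsq_gt0 x; have Q0 := poisson_den_gt0 (s * x) t0.
  rewrite /cos_density /sin_density; field.
  by rewrite ts (gt_eqF S0) (gt_eqF Q0).
- exact: cos_lommel_kernelE.
Qed.

(** As for the cosine kernel, with the decomposition
  1/(1 + x^2) * t/(s^2 x^2 + t^2)
    = (t/(1 + x^2) - s^2 * t/(t^2 + s^2 x^2)) / (t^2 - s^2),
whose integral over x > 0 is again (pi/2) (t - s) / (t^2 - s^2). *)
Lemma sin_kernel_expanding : expanding (@sin_lommel_kernel R).
Proof.
apply: (@kernel_expanding _ sin (@sin_density R) (fun p t => t / (p ^+ 2 + t ^+ 2)) (-1)).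
- exact: continuous_sin.
- exact: sin_le1.
- by rewrite normrN normr1.
- move=> p t s p0; have [i1 I1] := exp_cos_integral (t - s) p0.
  have [i2 I2] := exp_cos_integral (- t - s) p0.
  rewrite /poisson -I1 -I2 mulN1r -(RintegralB _ i1 i2)//.
  have i12 : mu.-integrable D (EFin \o fun x => expR (- (p * x)) * cos (x * (t - s)) -
    expR (- (p * x)) * cos (x * (- t - s))) by exact: integrable_EFinB.
  rewrite -(RintegralZr _ _ i12)//; apply: eq_Rintegral => x _.
  by rewrite !mulrBr mulrN -opprD !cosB cosN cosD; field.
- exact: continuous_sin_density.
- by move=> x x0; rewrite /sin_density invr_ge0; exact/ltW/oneDsq_gt0.
- by move=> x _; exact: sin_density_le1.
- by move=> p t p0; have [_] := exp_sin_integral t p0.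
- by apply: measurable_funM => //; exact: measurable_inv_sum_sqr.
- by move=> p t p0; apply: cvgMl_tmp; exact: continuous_lorentz.
- move=> a p s t x a0 as_ at_ p0 x0.
  have S0 : 0 <= sin_density x by rewrite invr_ge0; exact/ltW/oneDsq_gt0.
  have t0 : 0 < t by exact: lt_le_trans at_.
  set q := p + s * x.
  have Q0 : 0 < q ^+ 2 + t ^+ 2 by rewrite addrC; exact: poisson_den_gt0.
  rewrite ger0_norm; last first.
    exact: mulr_ge0 S0 (divr_ge0 (ltW t0) (ltW Q0)).
  rewrite mulrC; apply: ler_wpM2r => //.
  rewrite ler_pdivrMr// mulrC ler_pdivlMr//.
  have : t * a <= t * t by rewrite ler_wpM2l// ltW.
  by have := sqr_ge0 q; rewrite -[t * t]expr2; lra.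
- move=> a p s x a0 as_ p0 x0.
  have S0 : 0 <= sin_density x by rewrite invr_ge0; exact/ltW/oneDsq_gt0.
  have sx0 : 0 < s * x by rewrite mulr_gt0// (lt_le_trans a0).
  rewrite mulrC; apply: ler_wpM2r => //.
  apply: (@le_trans _ _ p^-1); last by rewrite lerDr invr_ge0 ltW.
  by rewrite lef_pV2 ?posrE ?addr_gt0// lerDl ltW.
- move=> s t s0 t0 st; have ts : t ^+ 2 - s ^+ 2 != 0.
    by rewrite subr_sqr mulf_neq0 ?(gt_eqF (addr_gt0 t0 s0))// subr_eq0 eq_sym.
  have [sn0 stn0] : s != 0 /\ s + t != 0 by rewrite (gt_eqF s0) (gt_eqF (addr_gt0 s0 t0)).
  transitivity (t / (t ^+ 2 - s ^+ 2) * (pi / 2) + - s ^+ 2 / (t ^+ 2 - s ^+ 2) * (pi / 2 / s));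
    last first.
    by generalize (pi : R) => q; field; rewrite sn0 stn0.
  rewrite -(lorentz_comb_integral _ _ s0 t0); apply: eq_Rintegral => x _.
  have S0 := oneDsq_gt0 x; have Q0 := poisson_den_gt0 (s * x) t0.
  rewrite /sin_density; field.
  by rewrite ts (gt_eqF S0) (gt_eqF Q0).
- exact: sin_lommel_kernelE.
Qed.

Lemma measurable_cos_kernel x : 0 < x -> measurable_fun D (@cos_lommel_kernel R x).
Proof.
apply: (measurable_kernel (e := cos) (m := @cos_density R)).
- exact: continuous_cos.
- exact: continuous_cos_density.
- exact: cos_lommel_kernelE.
Qed.

Lemma measurable_sin_kernel x : 0 < x -> measurable_fun D (@sin_lommel_kernel R x).
Proof.
apply: (measurable_kernel (e := sin) (m := @sin_density R)).
- exact: continuous_sin.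
- exact: continuous_sin_density.
- exact: sin_lommel_kernelE.
Qed.

End lommel_kernels.

(** * Solutions of the equation for an expanding kernel *)

Section final.
Variable R : realType.
Notation mu := (@lebesgue_measure R).
Notation D := (@Rplus R).
Implicit Types (a b x t : R).

Hint Extern 0 (measurable (@Rplus _)) => solve [exact: measurable_itv] : core.

Variables (k : R -> R -> R) (lam : R).
Hypotheses (k_exp : expanding k) (lam2 : -2 < lam < 2).

Notation I N := `[(N%:R)^-1, N%:R]%classic.
Notation trunc f N x := (\int[mu]_(t in I N) (k x t * f t)).

Definition ae_eq0 (f : R -> R) := {ae mu, forall x, D x -> f x = 0}.

Section real_solution.
Variables (f g : R -> R).
Hypotheses (mf : measurable_fun D f) (if2 : mu.-integrable D (EFin \o fun x => f x ^+ 2)).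
Hypotheses (mg : measurable_fun D g).
Hypothesis cvg_g :
  (\int[mu]_(x in D) ((trunc f N x - g x) ^+ 2)%:E)%E @[N --> \oo] --> 0%E.
Hypothesis fg : {ae mu, forall x, D x -> 2 * Num.sqrt (2 / pi) * g x = lam * f x}.

Let q : R := lam ^+ 2 / 4.

Let q_lt1 : q < 1.
Proof. by rewrite /q; have /andP[] := lam2; nra. Qed.

Let q_ge0 : 0 <= q.
Proof. by rewrite /q divr_ge0 ?sqr_ge0. Qed.

Let F := \int[mu]_(x in D) f x ^+ 2.

Let E N : \bar R := (\int[mu]_(x in D) ((trunc f N x - g x) ^+ 2)%:E)%E.

(** Square the equation 2 sqrt (2/pi) g = lam f and integrate. *)
Lemma g_norm : (\int[mu]_(x in D) (g x ^+ 2)%:E = (q * (pi / 2) * F)%:E)%E.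
Proof.
rewrite EFinM /F EFin_Rintegral// -integralZl//.
apply: ge0_ae_eq_integral => //.
- by apply/measurable_EFinP; exact: measurable_funX.
- apply/measurable_EFinP; apply: measurable_funM => //; exact: measurable_funX.
- by move=> x _; rewrite lee_fin sqr_ge0.
- move=> x _; rewrite -EFinM lee_fin mulr_ge0 ?sqr_ge0// mulr_ge0//.
  by rewrite divr_ge0 ?pi_ge0.
move: fg; apply: (@filterS _ _ (ae_filter_ringOfSetsType mu)) => x h Dx; rewrite -EFinM; congr EFin.
have p0 : 0 < 2 / pi :> R by rewrite divr_gt0// pi_gt0.
have : (2 * Num.sqrt (2 / pi) * g x) ^+ 2 = (lam * f x) ^+ 2 by rewrite h.
rewrite !exprMn sqr_sqrtr ?(ltW p0)//.
have p1 : pi != 0 :> R by rewrite gt_eqF ?pi_gt0.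
rewrite /q; move: p1; generalize (pi : R) => c c0 hh.
have -> : lam ^+ 2 / 4 * (c / 2) * f x ^+ 2 = c / 8 * (lam ^+ 2 * f x ^+ 2) by field.
by rewrite -hh; field.
Qed.

(** Apply [expanding] to f on ]1/N, N[, then bound the square of the truncated integral
by A^2 <= (1 + eta) B^2 + (1 + 1/eta) (A - B)^2.  The interval is nonempty only for
N > 1. *)
Lemma truncation_bound N (eta : R) : (1 < N)%N -> 0 < eta ->
  ((pi / 2 * \int[mu]_(t in `](N%:R)^-1, N%:R[) f t ^+ 2)%:E <=
   ((1 + eta) * (q * (pi / 2) * F))%:E + (1 + eta^-1)%:E * E N)%E.
Proof.
move=> N1 eta0; have N0 : 0 < N%:R :> R by rewrite ltr0n (ltn_trans _ N1).
have a0 : 0 < N%:R^-1 :> R by rewrite invr_gt0.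
have ab : N%:R^-1 < N%:R :> R.
  by apply: (@lt_trans _ _ 1); rewrite ?invf_lt1 ?ltr1n.
have [mA hA] := k_exp a0 ab mf if2.
apply: le_trans hA _.
rewrite EFinM -g_norm -ge0_integralZl_EFin//; last 3 first.
- by move=> x _; rewrite lee_fin sqr_ge0.
- by apply/measurable_EFinP; exact: measurable_funX.
- by rewrite addr_ge0// ltW.
have mAg : measurable_fun D (fun x => ((trunc f N x - g x) ^+ 2)%:E).
  by apply/measurable_EFinP; apply: measurable_funX; exact: measurable_funB.
rewrite -ge0_integralZl_EFin//; last 2 first.
- by move=> x _; rewrite lee_fin sqr_ge0.
- by rewrite addr_ge0// invr_ge0 ltW.
rewrite -ge0_integralD//; last 4 first.
- by move=> x _; rewrite -EFinM lee_fin mulr_ge0 ?sqr_ge0// addr_ge0// ltW.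
- by apply/measurable_EFinP; apply: measurable_funM => //; exact: measurable_funX.
- by move=> x _; rewrite -EFinM lee_fin mulr_ge0 ?sqr_ge0// addr_ge0// invr_ge0 ltW.
- apply/measurable_EFinP; apply: measurable_funM => //.
  by apply: measurable_funX; exact: measurable_funB.
apply: ge0_le_integral => //.
- by move=> x _; rewrite lee_fin sqr_ge0.
- by apply/measurable_EFinP; exact: measurable_funX.
- apply/measurable_EFinP; apply: measurable_funD; apply: measurable_funM => //.
    exact: measurable_funX.
  by apply: measurable_funX; exact: measurable_funB.
move=> x _; rewrite -!EFinM -EFinD lee_fin.
set A := trunc f N x; set B := g x.
(* The difference of the two sides is a square. *)
rewrite -subr_ge0 (_ : _ - _ = (eta * B - (A - B)) ^+ 2 / eta).
  by rewrite mulr_ge0 ?sqr_ge0// invr_ge0 ltW.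
by field; rewrite gt_eqF.
Qed.

Lemma cvg_truncation_norm :
  \int[mu]_(t in `](N%:R)^-1, N%:R[) f t ^+ 2 @[N --> \oo] --> F.
Proof.
pose J (N : nat) : set R := `](N%:R)^-1, N%:R[%classic.
have mJ N : measurable (J N) by exact: measurable_itv.
have JD N : J N `&` D = J N.
  apply/setIidPl => x; rewrite /J /= in_itv/= RplusE => /andP[h _].
  by apply: le_lt_trans h; rewrite invr_ge0.
rewrite (_ : (fun N => _) = fun N => \int[mu]_(t in D) ((fun t => f t ^+ 2) \_ (J N)) t); last first.
  by apply/funext => N; rewrite -Rintegral_mkcondl JD.
have [||||_ L] := @Rintegral_dominated_cvg _ _ _ mu D
  (fun N => (fun t => f t ^+ 2) \_ (J N)) (fun t => f t ^+ 2) (fun t => f t ^+ 2) (measurable_itv _)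
  _ _ _ _; last exact: L.
- move=> N; have mf2 : measurable_fun D (fun t => f t ^+ 2) by exact: measurable_funX.
  apply/measurable_restrict; [exact: mJ|by []|].
  have sJ : D `&` J N `<=` D by apply: subIsetl.
  exact: (measurable_funS _ sJ mf2).
- move=> x; rewrite RplusE => x0; apply: cvg_near_cst.
  have := nbhs_infty_gtr (Num.max x x^-1); apply: filterS => N.
  rewrite gt_max => /andP[h1 h2].
  rewrite patchE mem_set// /J /= in_itv/= h1 andbT.
  by rewrite -(invrK x) ltf_pV2 ?posrE ?invr_gt0// (lt_trans x0).
- exact: if2.
- move=> N x _; rewrite patchE; case: ifP => _; rewrite ?normr0 ?sqr_ge0//.
  by rewrite ger0_norm ?sqr_ge0.
Qed.

(** In the limit F <= (1 + eta) q F, where F is the integral of f^2 and q = lam^2/4 < 1.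
With eta = 1 - q the factor 1 - (1 + eta) q is (1 - q)^2 > 0, so F = 0. *)
Lemma real_solution_eq0 : ae_eq0 f.
Proof.
have p0 : 0 < pi / 2 :> R by rewrite divr_gt0// pi_gt0.
pose eta : R := 1 - q; have eta0 : 0 < eta by rewrite subr_gt0.
have F0 : 0 <= F by apply: Rintegral_ge0 => x _; exact: sqr_ge0.
have Efin : \forall N \near \oo, E N \is a fin_num.
  by have /fine_cvgP[] := cvg_g.
have Ecvg : fine (E N) @[N --> \oo] --> (0 : R) by have /fine_cvgP[] := cvg_g.
have bnd : pi / 2 * F <= (1 + eta) * (q * (pi / 2) * F) + (1 + eta^-1) * 0.
  have cl : pi / 2 * \int[mu]_(t in `](N%:R)^-1, N%:R[) f t ^+ 2 @[N --> \oo] --> pi / 2 * F.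
    by apply: cvgMl_tmp; exact: cvg_truncation_norm.
  have cr : (1 + eta) * (q * (pi / 2) * F) + (1 + eta^-1) * fine (E N) @[N --> \oo] -->
      (1 + eta) * (q * (pi / 2) * F) + (1 + eta^-1) * 0.
    by apply: cvgD; [exact: cvg_cst|apply: cvgMl_tmp].
  apply: (ler_cvg_to cl cr).
  near=> N; have N1 : (1 < N)%N by near: N; exact: nbhs_infty_gt.
  have EN : E N \is a fin_num by near: N.
  have := truncation_bound N1 eta0.
  by rewrite -[E N]fineK// -EFinM -EFinD lee_fin.
have F00 : F = 0.
  have : pi / 2 * ((1 - (1 + eta) * q) * F) <= 0.
    have -> : pi / 2 * ((1 - (1 + eta) * q) * F) =
        pi / 2 * F - (1 + eta) * (q * (pi / 2) * F) by ring.
    by move: bnd; rewrite mulr0 addr0 subr_le0.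
  rewrite pmulr_rle0// pmulr_rle0; last first.
    by rewrite (_ : _ - _ = eta ^+ 2) ?exprn_gt0// /eta; ring.
  by move=> h; apply/eqP; rewrite eq_le h.
have mf2 : measurable_fun D (fun x => (f x ^+ 2)%:E).
  by apply/measurable_EFinP; exact: measurable_funX.
have : (\int[mu]_(x in D) `|(f x ^+ 2)%:E| = 0)%E.
  rewrite -[RHS](_ : F%:E = 0%E); last by rewrite F00.
  rewrite EFin_Rintegral//; apply: eq_integral => x _ /=.
  by rewrite ger0_norm ?sqr_ge0.
move/(ae_eq_integral_abs mu (measurable_itv _) mf2).
apply: (@filterS _ _ (ae_filter_ringOfSetsType mu)) => x h Dx; have /= [] := h Dx.
by move/eqP; rewrite sqrf_eq0 => /eqP.
Unshelve. all: by end_near. Qed.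

End real_solution.

Local Open Scope complex_scope.

Lemma ReZ (c : R) (z : R[i]) : complex.Re (c%:C * z) = c * complex.Re z.
Proof. by case: z => a b /=; rewrite mul0r subr0. Qed.

Lemma ImZ (c : R) (z : R[i]) : complex.Im (c%:C * z) = c * complex.Im z.
Proof. by case: z => a b /=; rewrite mul0r addr0. Qed.

Lemma ReB (z w : R[i]) : complex.Re (z - w) = complex.Re z - complex.Re w.
Proof. by case: z w => a b []. Qed.

Lemma ImB (z w : R[i]) : complex.Im (z - w) = complex.Im z - complex.Im w.
Proof. by case: z w => a b []. Qed.

Lemma Re_truncated f N x :
  complex.Re (truncated_integral k f N x) = trunc (fun t => complex.Re (f t)) N x.
Proof. by apply: eq_Rintegral => t _; rewrite ReZ. Qed.

Lemma Im_truncated f N x :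
  complex.Im (truncated_integral k f N x) = trunc (fun t => complex.Im (f t)) N x.
Proof. by apply: eq_Rintegral => t _; rewrite ImZ. Qed.

(** Stated for any part P of a complex number whose square is at most that of the
modulus, so as to serve for the real and the imaginary part. *)
Lemma inL2_part (f : R -> R[i]) (P : R[i] -> R) : (forall z, P z ^+ 2 <= sqr_modulus z) ->
  measurable_fun D (fun x => P (f x)) -> inL2 f ->
  mu.-integrable D (EFin \o fun x => P (f x) ^+ 2).
Proof.
move=> hP mP [mRe mIm fin]; apply/integrableP; split.
  by apply/measurable_EFinP; exact: measurable_funX.
apply: le_lt_trans fin; apply: ge0_le_integral => //.
- by apply/measurable_EFinP; apply: measurableT_comp => //; exact: measurable_funX.
- by apply/measurable_EFinP; apply: measurable_funD; exact: measurable_funX.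
- by move=> x _; rewrite /= lee_fin ger0_norm ?sqr_ge0.
Qed.

Lemma Re_le (z : R[i]) : complex.Re z ^+ 2 <= sqr_modulus z.
Proof. by rewrite lerDl sqr_ge0. Qed.

Lemma Im_le (z : R[i]) : complex.Im z ^+ 2 <= sqr_modulus z.
Proof. by rewrite lerDr sqr_ge0. Qed.

(** Also for either part at once: [P] is the real or the imaginary part.  The kernel is
real, so taking parts commutes with the truncated integrals. *)
Lemma cvg_part (P : R[i] -> R) (f g : R -> R[i]) :
  (forall z, P z ^+ 2 <= sqr_modulus z) -> (forall z w, P (z - w) = P z - P w) ->
  (forall N x, P (truncated_integral k f N x) = trunc (fun t => P (f t)) N x) ->
  measurable_fun D (fun x => P (f x)) ->
  measurable_fun D (fun x => P (g x)) -> inL2 f -> inL2 g ->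
  sqr_normL2 (fun x => truncated_integral k f N x - g x) @[N --> \oo] --> 0%E ->
  (\int[mu]_(x in D) ((trunc (fun t => P (f t)) N x - P (g x)) ^+ 2)%:E)%E @[N --> \oo] --> 0%E.
Proof.
move=> Pz PB PT mPf mPg f2 g2; apply: squeeze_cvge; last exact: cvg_cst.
near=> N; have N1 : (1 < N)%N by near: N; exact: nbhs_infty_gt.
apply/andP; split; first by apply: integral_ge0 => x _; rewrite lee_fin sqr_ge0.
have N0 : 0 < N%:R :> R by rewrite ltr0n (ltn_trans _ N1).
have a0 : 0 < N%:R^-1 :> R by rewrite invr_gt0.
have ab : N%:R^-1 < N%:R :> R.
  by apply: (@lt_trans _ _ 1); rewrite ?invf_lt1 ?ltr1n.
have [mRe mIm _] := f2; have [mgRe mgIm _] := g2.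
have [m1 _] := k_exp a0 ab mRe (inL2_part Re_le mRe f2).
have [m2 _] := k_exp a0 ab mIm (inL2_part Im_le mIm f2).
have [m3 _] := k_exp a0 ab mPf (inL2_part Pz mPf f2).
apply: ge0_le_integral => //.
- by move=> x _; rewrite lee_fin sqr_ge0.
- by apply/measurable_EFinP; apply: measurable_funX; exact: measurable_funB.
- apply/measurable_EFinP; apply: measurable_funD; apply: measurable_funX.
    apply: (eq_measurable_fun (fun x => trunc (fun t => complex.Re (f t)) N x - complex.Re (g x))).
      by move=> x _; rewrite ReB Re_truncated.
    exact: measurable_funB.
  apply: (eq_measurable_fun (fun x => trunc (fun t => complex.Im (f t)) N x - complex.Im (g x))).
    by move=> x _; rewrite ImB Im_truncated.
  exact: measurable_funB.
- by move=> x _; rewrite lee_fin -PT -PB.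
Unshelve. all: by end_near. Qed.

Lemma solution_ae0 f : inL2 f -> solves k lam f -> ae_eq_Rplus f (fun=> 0).
Proof.
move=> f2 [g [g2 cg] fg]; have [mRe mIm _] := f2; have [mgRe mgIm _] := g2.
have R0 : ae_eq0 (fun x => complex.Re (f x)).
  apply: (@real_solution_eq0 _ (fun x => complex.Re (g x))) => //.
  - exact: inL2_part Re_le mRe f2.
  - apply: cvg_part => //; [exact: Re_le|exact: ReB|exact: Re_truncated].
  - move: fg; apply: (@filterS _ _ (ae_filter_ringOfSetsType mu)) => x h Dx.
    by have := congr1 (@complex.Re R) (h Dx); rewrite !ReZ.
have I0 : ae_eq0 (fun x => complex.Im (f x)).
  apply: (@real_solution_eq0 _ (fun x => complex.Im (g x))) => //.
  - exact: inL2_part Im_le mIm f2.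
  - apply: cvg_part => //; [exact: Im_le|exact: ImB|exact: Im_truncated].
  - move: fg; apply: (@filterS _ _ (ae_filter_ringOfSetsType mu)) => x h Dx.
    by have := congr1 (@complex.Im R) (h Dx); rewrite !ImZ.
move: R0 I0; apply: (@filterS2 _ _ (ae_filter_ringOfSetsType mu)) => x h1 h2 Dx.
by case: (f x) (h1 Dx) (h2 Dx) => u v /= -> ->.
Qed.

Hypothesis mk : forall x, 0 < x -> measurable_fun D (k x).

(** The measurability of [k x] ensures that the integrand is measurable, so that its
integral does not see the null set where f differs from 0. *)
Lemma truncated_ae0 f N x : (0 < N)%N -> 0 < x -> measurable_fun D f -> ae_eq0 f ->
  trunc f N x = 0.
Proof.
move=> N0 x0 mf f0; have sI : I N `<=` D.
  by apply: subset_Rplus; rewrite invr_gt0 ltr0n.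
rewrite /Rintegral (_ : integral _ _ _ = 0%E)//.
rewrite (ae_eq_integral (cst 0%E)) ?integral0//.
- apply/measurable_EFinP; apply: measurable_funS sI _ => //.
  by apply: measurable_funM => //; exact: mk.
- move: f0; apply: (@filterS _ _ (ae_filter_ringOfSetsType mu)) => t h It.
  by rewrite h ?mulr0//; exact: sI.
Qed.

(** The mean square integral of f is the zero function, since all truncated integrals
with N > 0 vanish. *)
Lemma ae0_solution f : inL2 f -> ae_eq_Rplus f (fun=> 0) -> solves k lam f.
Proof.
move=> [mRe mIm fin] f0.
have R0 : ae_eq0 (fun x => complex.Re (f x)).
  by move: f0; apply: (@filterS _ _ (ae_filter_ringOfSetsType mu)) => x h Dx; rewrite h.
have I0 : ae_eq0 (fun x => complex.Im (f x)).
  by move: f0; apply: (@filterS _ _ (ae_filter_ringOfSetsType mu)) => x h Dx; rewrite h.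
exists (fun=> 0); last first.
  by move: f0; apply: (@filterS _ _ (ae_filter_ringOfSetsType mu)) => x h Dx; rewrite h ?mulr0.
split.
  split; [exact: measurable_cst|exact: measurable_cst|].
  rewrite /sqr_normL2 integral0_eq ?ltry// => x _.
  by rewrite /sqr_modulus /= expr0n addr0.
apply: cvg_near_cst; near=> N; have N0 : (0 < N)%N by near: N; exact: nbhs_infty_gt.
apply: integral0_eq => x; rewrite RplusE => x0.
rewrite subr0 /sqr_modulus Re_truncated Im_truncated !truncated_ae0//.
by rewrite expr0n addr0.
Unshelve. all: by end_near. Qed.

End final.

Theorem corollary6 (R : realType) (lam : R) (hlam : -2 < lam < 2) :
  (forall f : R -> R[i], inL2 f ->
     (solves (@cos_lommel_kernel R) lam f <-> ae_eq_Rplus f (fun=> 0)))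
  /\
  (forall f : R -> R[i], inL2 f ->
     (solves (@sin_lommel_kernel R) lam f <-> ae_eq_Rplus f (fun=> 0))).
Proof.
split=> f f2; split.
- exact: solution_ae0 (@cos_kernel_expanding R) hlam _ f2.
- exact: ae0_solution (@measurable_cos_kernel R) _ f2.
- exact: solution_ae0 (@sin_kernel_expanding R) hlam _ f2.
- exact: ae0_solution (@measurable_sin_kernel R) _ f2.
Qed.
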